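(* Let $\sigma,\rho\ge 0$ and $\nu>0$. For $n\in\mathbb N$ let $\mathcal F_n$ be the set of all probability distributions on $\mathbb R^n$ supported on $\mathcal S_n(\sigma,\rho)$. The capacity $C$ of the $(\sigma,\rho)$-power-constrained scalar AWGN channel with noise power $\nu$ is given by $$C=\lim_{n\to\infty}\frac1n\sup_{p_{X^n}\in\mathcal F_n} I(X^n;Y^n),$$ where $X^n\sim p_{X^n}$ and $Y^n=X^n+Z^n$ is the corresponding channel output.
   Context: All logarithms (and mutual informations and rates) are in nats. $\mathcal S_n(\sigma,\rho)=\{x^n\in\mathbb R^n:\ \sum_{j=k+1}^{l}x_j^2\le \sigma+(l-k)\rho\ \text{ for all } 0\le k<l\le n\}$. AWGN channel with noise power $\nu$: input $X_i$, output $Y_i=X_i+Z_i$, where $Z_1,Z_2,\dots$ are i.i.d. $\mathcal N(0,\nu)$ independent of the input. A code of block length $n$ and rate $R$ for the $(\sigma,\rho)$-power constraint consists of a message set $\{1,\dots,\lfloor e^{nR}\rfloor\}$, an encoder mapping messages into $\mathcal S_n(\sigma,\rho)$, and a decoder mapping $\mathbb R^n$ to messages. A rate $R$ is achievable if there is a sequence of such codes ($n\to\infty$) whose probability of decoding error (for a uniformly distributed message) tends to $0$. The capacity $C$ is the supremum of achievable rates. ''Supported on $\mathcal S_n(\sigma,\rho)$'' means that $X^n\in\mathcal S_n(\sigma,\rho)$ with probability one. *)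

(* Defs.v *)
From HB Require Import structures.
From mathcomp Require Import all_boot all_order all_algebra.
From mathcomp Require Import all_classical all_reals all_analysis.

Set Implicit Arguments.
Unset Strict Implicit.
Unset Printing Implicit Defensive.

Import Order.TTheory GRing.Theory Num.Theory.
Import numFieldNormedType.Exports.

Local Open Scope classical_set_scope.
Local Open Scope ring_scope.

Section projections.
Context d1 d2 (T1 : measurableType d1) (T2 : measurableType d2).

Definition proj1_mfun : T1 * T2 -> T1 := fst.

HB.instance Definition _ :=
  isMeasurableFun.Build _ _ _ _ proj1_mfun (@measurable_fst _ _ T1 T2).

End projections.

Section iid_law.
Context d (T : measurableType d) (R : realType).

Definition tuple_cons n (p : T * n.-tuple T) : n.+1.-tuple T :=
  [the n.+1.-tuple T of p.1 :: p.2].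

Lemma measurable_tuple_cons n : measurable_fun setT (@tuple_cons n).
Proof. by apply: measurable_cons; [exact: measurable_fst|exact: measurable_snd]. Qed.

HB.instance Definition _ n :=
  isMeasurableFun.Build _ _ _ _ (@tuple_cons n) (@measurable_tuple_cons n).

(* The n-fold product measure of P, i.e. the joint law of n independent
   variables of law P; iid_law_box below is the product rule. *)
Fixpoint iid_law (P : probability T R) (n : nat) : probability (n.-tuple T) R :=
  match n with
  | 0 => \d_([tuple] : 0.-tuple T)
  | m.+1 => distribution (P \x iid_law P m)%E (@tuple_cons m)
  end.

Lemma iid_law_box (P : probability T R) (n : nat) (A : 'I_n -> set T) :
  (forall i, measurable (A i)) ->
  iid_law P n [set x | forall i, A i (tnth x i)] = (\prod_(i < n) P (A i))%E.
Proof.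
elim: n A => [|n IH] A mA /=.
  rewrite big_ord0 diracE mem_set//= => i.
  by case: i.
rewrite big_ord_recl -IH; last by move=> i; exact: mA.
rewrite /distribution /pushforward -product_measure1E//; last first.
  suff -> : [set x : n.-tuple T | forall i, A (lift ord0 i) (tnth x i)] =
      \bigcap_(i in [set: 'I_n])
        ((fun x : n.-tuple T => tnth x i) @^-1` A (lift ord0 i)).
    apply: fin_bigcap_measurable => // i _.
    by rewrite -[X in measurable X]setTI; exact: measurable_tnth.
  by apply/seteqP; split => x /= h i => [_|]; exact: h.
congr (_ _); apply/seteqP; split => [[a x] /= h|[a x] /= [h1 h2] i].
  split; first by have := h ord0; rewrite tnth0.
  by move=> i; have := h (lift ord0 i); rewrite tnthS.
by case: (unliftP ord0 i) => [j|] ->; rewrite ?tnth0 ?tnthS; [exact: h2|exact: h1].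
Qed.

End iid_law.

Section mutual_information.
Local Open Scope charge_scope.
Local Open Scope ereal_scope.

(* Kullback-Leibler divergence, in nats. *)
Definition kl_divergence d (T : measurableType d) (R : realType)
    (P Q : probability T R) : \bar R :=
  if `[< P `<< Q >] then
    \int[P]_x lne (('d (charge_of_finite_measure P) '/d Q) x)
  else +oo.

Context d d1 d2 (T : measurableType d) (T1 : measurableType d1)
  (T2 : measurableType d2) (R : realType) (P : probability T R).

Definition pair_rv (X : {RV P >-> T1}) (Y : {RV P >-> T2}) (w : T) : T1 * T2 :=
  (X w, Y w).

Lemma measurable_pair_rv (X : {RV P >-> T1}) (Y : {RV P >-> T2}) :
  measurable_fun setT (pair_rv X Y).
Proof. exact: measurable_fun_pair. Qed.

HB.instance Definition _ (X : {RV P >-> T1}) (Y : {RV P >-> T2}) :=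
  isMeasurableFun.Build _ _ _ _ (pair_rv X Y) (measurable_pair_rv X Y).

Definition mutual_information (X : {RV P >-> T1}) (Y : {RV P >-> T2}) : \bar R :=
  kl_divergence (distribution P (pair_rv X Y))
                (distribution P X \x distribution P Y).

End mutual_information.

(* The Borel structure on R comes from measurableTypeR, as for normal_prob. *)
Notation Rn R n := (n.-tuple (measurableTypeR R)).

(* The indices k <= j < l are 0-based, so tnth x j is the coordinate x_{j+1}. *)
Definition power_constrained (R : realType) (n : nat) (sigma rho : R) : set (Rn R n) :=
  [set x | forall k l : nat, (k < l <= n)%N ->
     \sum_(j < n | (k <= j < l)%N) (tnth x j : R) ^+ 2
       <= sigma + (l - k)%:R * rho].

Arguments power_constrained {R} n sigma rho _.

Definition addv (R : realType) n (x z : Rn R n) : Rn R n :=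
  [tuple (tnth x i : R) + tnth z i | i < n].

Definition channel_output (R : realType) n (xz : Rn R n * Rn R n) : Rn R n :=
  addv xz.1 xz.2.

Lemma measurable_channel_output (R : realType) n : measurable_fun setT (@channel_output R n).
Proof.
apply/measurable_fun_tnthP => i.
rewrite (_ : _ \o _ = (fun xz : Rn R n * Rn R n => (tnth xz.1 i : R) + tnth xz.2 i)).
  apply: measurable_realfun.measurable_funD.
    exact: (measurableT_comp (@measurable_tnth _ (measurableTypeR R) n i)
              (@measurable_fst _ _ (Rn R n) (Rn R n))).
  exact: (measurableT_comp (@measurable_tnth _ (measurableTypeR R) n i)
            (@measurable_snd _ _ (Rn R n) (Rn R n))).
by apply/funext => xz /=; rewrite tnth_mktuple.
Qed.

HB.instance Definition _ (R : realType) n :=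
  isMeasurableFun.Build _ _ _ _ (@channel_output R n) (@measurable_channel_output R n).

(* The second argument of normal_prob is the standard deviation. *)
Definition noise_law (R : realType) (nu : R) (n : nat) : probability (Rn R n) R :=
  iid_law (normal_prob 0 (Num.sqrt nu)) n.

(* I(X;Y) for X of law p and Y = X + Z, with Z the noise, independent of X:
   the underlying probability space carries the pair (X, Z). *)
Definition channel_information (R : realType) (nu : R) (n : nat)
    (p : probability (Rn R n) R) : \bar R :=
  mutual_information (P := (p \x noise_law nu n)%E)
    (@proj1_mfun _ _ (Rn R n) (Rn R n)) (@channel_output R n).

Definition input_laws (R : realType) (n : nat) (sigma rho : R) :
    set (probability (Rn R n) R) :=
  [set p | p (power_constrained n sigma rho) = 1%E].

Arguments input_laws {R} n sigma rho _.

Record code (R : realType) (n M : nat) (sigma rho : R) := Code {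
  encoder : 'I_M -> Rn R n;
  decoder : Rn R n -> 'I_M;
  encoder_constrained : forall m, power_constrained n sigma rho (encoder m);
  decoder_measurable : forall m, measurable (decoder @^-1` [set m]) }.

Definition error_probability (R : realType) (nu : R) (n M : nat) (sigma rho : R)
    (c : code n M sigma rho) : \bar R :=
  ((M%:R^-1)%:E *
   \sum_(m < M) noise_law nu n [set z | decoder c (addv (encoder c m) z) <> m])%E.

(* A negative rate is never achievable: for n > 0 the message set would be empty,
   so that no decoder exists. *)
Definition achievable (R : realType) (sigma rho nu r : R) : Prop :=
  exists c : forall n, code n (Num.truncn (expR (n%:R * r))) sigma rho,
    error_probability nu (c n) @[n --> \oo] --> 0%E.

Definition capacity (R : realType) (sigma rho nu : R) : \bar R :=
  ereal_sup [set r%:E | r in achievable sigma rho nu].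

(* Main.v *)
(* A random vector X, sent through the channel, has an output density
   f(y) = \int w(x, y) p(dx) with respect to the law of the noise, where
   w(x, y) = exp ((<x, y> - |x|^2 / 2) / nu) by the Cameron-Martin formula, and
   I(X; Y) is the mean of the information density l = ln (w / f).

   Converse: Fano's inequality for the uniform law on the codewords of a code
   of rate r bounds the supremum over F_n from below by n r - o(n).

   Achievability, for rho > 0: given p on F_n with I > c, pad its blocks with k
   zeros, k rho >= sigma, so that independent blocks may be concatenated. Some
   s in ]0, 1] satisfies E[e^(- s l)] < 1 - s c <= e^(- s c); this Chernoff
   bound is multiplicative over the blocks, and Feinstein's lemma turns it into
   codes of every rate below c / (n + k).

   If rho = 0 the energy is at most sigma, so I <= sigma / nu for every n and
   both sides vanish. *)

Require Import Defs.
From HB Require Import structures.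
From mathcomp Require Import all_boot all_order all_algebra.
From mathcomp Require Import all_classical all_reals all_analysis.
From mathcomp Require Import measurable_realfun ring lra zify.
(* Required again so that addv is the sum of vectors, not of vector spaces. *)
Require Import Defs.
Import Order.TTheory GRing.Theory Num.Theory.
Import numFieldNormedType.Exports.
Local Open Scope classical_set_scope.
Local Open Scope ring_scope.

Set Implicit Arguments.
Unset Strict Implicit.
Unset Printing Implicit Defensive.

(** * Channels with a density *)

(** The existence of the limit does not come from superadditivity. For x < C the converse gives n^-1
    sup I >= x for all large n; for x > C, one law in F_n with n large and I > n x would make a rate
    above C achievable, since the padding is negligible against n. The Chernoff bound replaces a law
    of large numbers because no moment of l beyond its mean then enters: I > c suffices, even when I
    is a priori infinite, and E[e^(- s l)] passes through concatenation as an exact product. With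
    the noise law as reference, the reference measure is a product probability, the zero word has
    density 1, and w(x, y) is bounded in x for each y, so that f is finite and positive everywhere
    and l is a real function. Most estimates are instances of e^u >= 1 + u, integrated as
    inequalities or identities between nonnegative functions; terms are moved across the relation
    rather than subtracted, so that infinite values do no harm. *)

Section density.
Local Open Scope ereal_scope.
Context d (T : measurableType d) (R : realType).

Lemma density_dominates (mu nu : {measure set T -> \bar R}) (w : T -> R) :
  measurable_fun setT w ->
  (forall A, measurable A -> nu A = \int[mu]_(x in A) (w x)%:E) ->
  nu `<< mu.
Proof.
move=> mw nuE; apply/null_content_dominatesP => A mA muA0.
rewrite nuE// null_set_integral//.
apply/measurable_EFinP; exact: measurable_funTS.
Qed.

(** The change of variables holds for the Radon-Nikodym derivative, with which [w] agrees
    [mu]-almost everywhere, both having the same integral over every measurable set. *)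
Lemma ge0_integral_density (mu : {sigma_finite_measure set T -> \bar R})
    (nu : {finite_measure set T -> \bar R}) (w : T -> R) (f : T -> \bar R) :
  measurable_fun setT w -> (forall x, (0 <= w x)%R) ->
  (forall A, measurable A -> nu A = \int[mu]_(x in A) (w x)%:E) ->
  measurable_fun setT f -> (forall x, 0 <= f x) ->
  \int[nu]_x f x = \int[mu]_x (f x * (w x)%:E).
Proof.
move=> mw w0 nuE mf f0.
have numu := density_dominates mw nuE.
have mEw : measurable_fun setT (EFin \o w) by exact/measurable_EFinP.
have intf := Radon_Nikodym_SigmaFinite.f_integrable numu.
have /= aew : ae_eq mu setT (Radon_Nikodym_SigmaFinite.f nu mu) (EFin \o w).
  apply: integral_ae_eq => // A _ mA.
  by rewrite -Radon_Nikodym_SigmaFinite.f_integral// nuE.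
rewrite -(Radon_Nikodym_SigmaFinite.change_of_variables numu)//.
apply: ge0_ae_eq_integral => //.
- by apply: emeasurable_funM => //; exact: measurable_int intf.
- exact: emeasurable_funM.
- by move=> x _; rewrite mule_ge0// Radon_Nikodym_SigmaFinite.f_ge0.
- by move=> x _; rewrite mule_ge0// lee_fin.
- exact: ae_eqe_mul2l.
Qed.

Lemma measurable_lne_fin (f : T -> \bar R) :
  (forall x, f x \is a fin_num) -> measurable_fun setT f ->
  measurable_fun setT (fun x => lne (f x)).
Proof.
move=> ffin mf.
have mff : measurable_fun setT (fine \o f).
  by apply: measurableT_comp => //; exact: fine_measurable.
rewrite (_ : (fun x => _) = (fun x => if (fine (f x) <= 0)%R then -oo
                                       else (ln (fine (f x)))%:E)).
  apply: measurable_fun_ifT => //; first exact: measurable_fun_ler.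
  by apply/measurable_EFinP; exact: measurableT_comp.
by apply/funext => x; rewrite -{1}(fineK (ffin x)).
Qed.

Local Open Scope charge_scope.

Lemma kl_divergence_density (P Q : probability T R) (w : T -> R) :
  measurable_fun setT w -> (forall x, (0 < w x)%R) ->
  (forall A, measurable A -> P A = \int[Q]_(x in A) (w x)%:E) ->
  kl_divergence P Q = \int[P]_x (ln (w x))%:E.
Proof.
move=> mw w0 PE.
have PQ := density_dominates mw PE.
rewrite /kl_divergence asboolT//.
have mEw : measurable_fun setT (EFin \o w) by exact/measurable_EFinP.
have intf : Q.-integrable setT ('d (charge_of_finite_measure P) '/d Q).
  exact: Radon_Nikodym_integrable.
have aew : ae_eq Q setT ('d (charge_of_finite_measure P) '/d Q) (EFin \o w).
  apply: integral_ae_eq => // A _ mA.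
  by rewrite -Radon_Nikodym_integral//= -PE.
apply: ae_eq_integral => //.
- apply: measurable_lne_fin; last exact: measurable_int intf.
  by move=> x; exact: Radon_Nikodym_fin_num.
- by apply/measurable_EFinP; exact: measurableT_comp.
(* The derivative equals [w] outside a [Q]-null set; the integral is over [P], for which this set is
   null by domination. *)
- have [A [mA A0 sA]] := aew.
  exists A; split => //.
    by apply: (null_content_dominatesP _ _).1 PQ _ mA _.
  apply: subset_trans sA => x /=; apply: contra_not => h _.
  by rewrite (h I)/= leNgt w0.
Qed.

End density.

Lemma integral_cst_probability d (T : measurableType d) (R : realType)
    (P : probability T R) (r : \bar R) : (\int[P]_x r = r)%E.
Proof.
transitivity (r * P setT)%E; first exact: integral_cst.
by rewrite probability_setT mule1.
Qed.

Section real_integrands.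
Local Open Scope ereal_scope.
Context d (T : measurableType d) (R : realType) (mu : {measure set T -> \bar R}).

Lemma ge0_integralD_real (a b : T -> R) :
  measurable_fun setT a -> measurable_fun setT b ->
  (forall x, (0 <= a x)%R) -> (forall x, (0 <= b x)%R) ->
  \int[mu]_x (a x + b x)%:E = \int[mu]_x (a x)%:E + \int[mu]_x (b x)%:E.
Proof.
move=> ma mb a0 b0; under eq_integral do rewrite EFinD.
by rewrite ge0_integralD//; do ?[by move=> x _; rewrite lee_fin];
  exact/measurable_EFinP.
Qed.

Lemma ge0_integralZl_real (k : R) (a : T -> R) :
  measurable_fun setT a -> (0 <= k)%R -> (forall x, (0 <= a x)%R) ->
  \int[mu]_x (k * a x)%:E = k%:E * \int[mu]_x (a x)%:E.
Proof.
move=> ma k0 a0; under eq_integral do rewrite EFinM.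
rewrite ge0_integralZl ?lee_fin//; first exact/measurable_EFinP.
by move=> x _; rewrite lee_fin.
Qed.

Lemma ge0_le_integral_real (a b : T -> R) :
  measurable_fun setT a -> measurable_fun setT b ->
  (forall x, (0 <= a x)%R) -> (forall x, (a x <= b x)%R) ->
  \int[mu]_x (a x)%:E <= \int[mu]_x (b x)%:E.
Proof.
move=> ma mb a0 ab; apply: ge0_le_integral => //.
- by move=> x _; rewrite lee_fin.
- exact/measurable_EFinP.
- exact/measurable_EFinP.
- by move=> x _; rewrite lee_fin.
Qed.

End real_integrands.

(** Applied to u = e^(- l / n), it makes the integrands to which Fatou's lemma is applied
    nonnegative. *)
Lemma bernoulli_ineq (R : realFieldType) (u : R) n :
  0 <= u -> 1 + n%:R * (u - 1) <= u ^+ n.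
Proof.
move=> u0; elim: n => [|n IH]; first by rewrite expr0 mul0r addr0.
rewrite exprS (le_trans _ (ler_wpM2l u0 IH))//.
rewrite -subr_ge0 (_ : _ - _ = n%:R * (u - 1) ^+ 2).
  by rewrite mulr_ge0// sqr_ge0.
by rewrite -natr1; ring.
Qed.

(** With v = l / (m + 1), a squeeze between v / (1 + v) <= 1 - e^(- v) <= v, both instances of e^u
    >= 1 + u. The left one needs 1 + v > 0, which for negative l holds only eventually. *)
Lemma cvg_expR_slope (R : realType) (l : R) :
  (fun m => m.+1%:R * (1 - expR (- (m.+1%:R^-1 * l)))) @ \oo --> l.
Proof.
have v0 : (fun m => m.+1%:R^-1 * l) @ \oo --> (0 : R).
  rewrite -(mul0r l); apply: cvgMl; exact: cvg_harmonic.
apply: (@squeeze_cvgr _ _ _ _ (fun m => l / (1 + m.+1%:R^-1 * l)) (fun=> l)).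
- near=> m.
  have v1 : 0 < 1 + m.+1%:R^-1 * l.
    rewrite -ltrBlDl sub0r; near: m.
    by apply: (cvgr_gt _ v0); rewrite ltrN10.
  move: v1; set v := m.+1%:R^-1 * l => v1.
  have lE : l = m.+1%:R * v by rewrite mulrA divff ?mul1r// pnatr_eq0.
  have e1 : expR (- v) <= (1 + v)^-1.
    by rewrite expRN lef_pV2 ?posrE ?expR_gt0// expR_ge1Dx.
  have e2 := expR_ge1Dx (- v).
  have m0 : 0 < m.+1%:R :> R by [].
  apply/andP; split.
    rewrite [in leLHS]lE -mulrA ler_pM2l//.
    have -> : v / (1 + v) = 1 - (1 + v)^-1.
      by apply: (mulIf (lt0r_neq0 v1)); rewrite mulrBl mulVf ?divfK ?lt0r_neq0//; ring.
    by rewrite lerD2l lerN2.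
  by rewrite [leRHS]lE ler_pM2l//; lra.
- have h : (fun m => 1 + m.+1%:R^-1 * l) @ \oo --> (1 + 0 : R).
    by apply: cvgD => //; exact: cvg_cst.
  rewrite -[X in _ --> X]divr1; apply: cvgM; first exact: cvg_cst.
  by apply: cvgV; rewrite ?oner_neq0// -[X in _ --> X]addr0.
- exact: cvg_cst.
Unshelve. all: end_near. Qed.

Section channel_definitions.
Context d1 d2 (X : measurableType d1) (Y : measurableType d2) (R : realType).
Variables (N : probability Y R) (w : X * Y -> R) (p : probability X R).

Definition output_density (y : Y) : R := fine (\int[p]_x (w (x, y))%:E)%E.

Definition information_density (z : X * Y) : R :=
  ln (w z / output_density z.2).

(* The summand f - w has integral 0; it makes the integrand of the mutual
   information nonnegative. *)
Definition information : \bar R :=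
  (\int[p \x N]_z (w z * information_density z + output_density z.2 - w z)%:E)%E.

(** E[e^(- s l)] under the joint law of input and output, which has density [w] with respect to
    [p \x N]. *)
Definition information_mgf (s : R) : \bar R :=
  (\int[p \x N]_z (w z * expR (- s * information_density z))%:E)%E.

End channel_definitions.

Section channel.
Context d1 d2 (X : measurableType d1) (Y : measurableType d2) (R : realType).
Variables (N : probability Y R) (w : X * Y -> R) (B : Y -> R).
Hypotheses (mw : measurable_fun setT w) (w_gt0 : forall z, 0 < w z)
  (w_le : forall x y, w (x, y) <= B y)
  (w1 : forall x, (\int[N]_y (w (x, y))%:E = 1)%E).
Variable p : probability X R.

Local Notation f := (output_density w p).
Local Notation ell := (information_density w p).

Let mw1 y : measurable_fun setT (fun x => w (x, y)).
Proof. exact: measurableT_comp. Qed.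

(** The bound [B y] is constant in x, so the integral is finite for every y and [fine] discards
    nothing. *)
Lemma output_densityE y : ((f y)%:E = \int[p]_x (w (x, y))%:E)%E.
Proof.
rewrite /output_density fineK// ge0_fin_numE; last first.
  by apply: integral_ge0 => x _; rewrite lee_fin ltW.
apply: (@le_lt_trans _ _ (\int[p]_x (B y)%:E)%E).
  apply: ge0_le_integral => //.
  - by move=> x _; rewrite lee_fin ltW.
  - exact/measurable_EFinP.
  - by move=> x _; rewrite lee_fin.
by rewrite integral_cst_probability ltry.
Qed.

(** A vanishing integral would force [w (x, y) = 0] for [p]-almost every x, whereas [w] is positive
    everywhere and [p] has mass 1. *)
Lemma output_density_gt0 y : 0 < f y.
Proof.
rewrite lt_neqAle; apply/andP; split; last first.
  rewrite -lee_fin output_densityE.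
  by apply: integral_ge0 => x _; rewrite lee_fin ltW.
apply/eqP => f0.
have : (\int[p]_x `|(w (x, y))%:E| = 0)%E.
  under eq_integral do rewrite gee0_abs ?lee_fin ?ltW//.
  by rewrite -output_densityE -f0.
move/ae_eq_integral_abs => /(_ measurableT) [].
  exact/measurable_EFinP.
move=> A [mA A0 sA].
have : p setT = 0%E.
  apply: subset_measure0 A0 => //.
  apply: subset_trans sA => x _ /= /(_ I) [] /eqP.
  by rewrite gt_eqF.
by rewrite probability_setT => /eqP; rewrite onee_eq0.
Qed.

Let f_gt0 := output_density_gt0.

Lemma measurable_output_density : measurable_fun setT f.
Proof.
apply: measurableT_comp => //.
apply: (@measurable_fun_fubini_tonelli_G _ _ _ _ _ p (EFin \o w)).
  exact/measurable_EFinP.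
by move=> z; rewrite lee_fin ltW.
Qed.

Let mf := measurable_output_density.

Let mf2 : measurable_fun setT (fun z : X * Y => f z.2).
Proof. exact: measurableT_comp. Qed.

Lemma measurable_information_density : measurable_fun setT ell.
Proof.
(* As f > 0, its inverse is e^(- ln f), a composition of measurable functions. *)
rewrite (_ : ell = @ln R \o (fun z => w z * expR (- ln (f z.2)))).
  apply: measurableT_comp => //; apply: measurable_funM => //.
  apply: measurableT_comp => //; apply: measurable_funN.
  exact: measurableT_comp.
by apply/funext => z /=; rewrite expRN lnK ?posrE.
Qed.

Let ml := measurable_information_density.

Lemma integral_channel_density : (\int[p \x N]_z (w z)%:E = 1)%E.
Proof.
rewrite (fubini_tonelli1 (EFin \o w))/=.
- under eq_integral do rewrite /fubini_F w1.
  by rewrite integral_cst_probability.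
- exact/measurable_EFinP.
- by move=> z; rewrite lee_fin ltW.
Qed.

Lemma ge0_integral_output (g : Y -> R) : measurable_fun setT g ->
  (forall y, 0 <= g y) ->
  (\int[p \x N]_z (w z * g z.2)%:E = \int[N]_y (f y * g y)%:E)%E.
Proof.
move=> mg g0.
rewrite (fubini_tonelli2 (fun z => (w z * g z.2)%:E))/=.
- apply: eq_integral => y _; rewrite /fubini_G/=.
  under eq_integral do rewrite EFinM.
  rewrite EFinM output_densityE.
  rewrite ge0_integralZr//.
  - exact/measurable_EFinP.
  - by move=> x _; rewrite lee_fin ltW.
  - by rewrite lee_fin.
- apply/measurable_EFinP; apply: measurable_funM => //.
  exact: measurableT_comp.
- by move=> z; rewrite lee_fin mulr_ge0// ltW.
Qed.

Lemma integral_output_density : (\int[N]_y (f y)%:E = 1)%E.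
Proof.
have := ge0_integral_output (@measurable_cst _ _ _ _ setT (1 : R)) (fun=> ler01).
under eq_integral do rewrite mulr1.
by under [in RHS]eq_integral do rewrite mulr1; rewrite integral_channel_density.
Qed.

Lemma ge0_integral_snd (g : Y -> R) : measurable_fun setT g ->
  (forall y, 0 <= g y) ->
  (\int[p \x N]_z (g z.2)%:E = \int[N]_y (g y)%:E)%E.
Proof.
move=> mg g0.
rewrite (fubini_tonelli2 (fun z => (g z.2)%:E))/=.
- apply: eq_integral => y _; rewrite /fubini_G/=.
  by rewrite integral_cst_probability.
- by apply/measurable_EFinP; exact: measurableT_comp.
- by move=> z; rewrite lee_fin.
Qed.

Lemma expR_information_density z : w z * expR (- ell z) = f z.2.
Proof.
rewrite /information_density expRN lnK ?posrE ?divr_gt0// invf_div mulrC.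
by rewrite divfK ?gt_eqF.
Qed.

(** Since f = w e^(- l), the integrand is w (l + e^(- l) - 1). *)
Lemma information_integrand_ge0 z : 0 <= w z * ell z + f z.2 - w z.
Proof.
rewrite -expR_information_density.
have -> : w z * ell z + w z * expR (- ell z) - w z =
    w z * (ell z + expR (- ell z) - 1) by ring.
apply: mulr_ge0; first exact: ltW.
by have := expR_ge1Dx (- ell z); lra.
Qed.

Lemma measurable_information_integrand :
  measurable_fun setT (fun z => w z * ell z + f z.2 - w z).
Proof.
by apply: measurable_funB => //; apply: measurable_funD => //;
  exact: measurable_funM.
Qed.

Lemma measurable_mgf_integrand s :
  measurable_fun setT (fun z => w z * expR (- s * ell z)).
Proof.
apply: measurable_funM => //; apply: measurableT_comp => //.
exact: measurable_funM.
Qed.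

(* Since (1 - e^(- s l)) / s tends to l as s tends to 0, Fatou's lemma shows
   that the slope at 0 of the moment generating function is the information. *)
Lemma information_mgf_lt (c : R) : (c%:E < information N w p)%E ->
  exists2 s : R, 0 < s <= 1 & (information_mgf N w p s < (1 - s * c)%:E)%E.
Proof.
move=> cI; apply: contrapT => noS.
have mgf_ge m : ((1 - m.+1%:R^-1 * c)%:E <= information_mgf N w p m.+1%:R^-1)%E.
  rewrite leNgt; apply/negP => h; apply: noS; exists m.+1%:R^-1 => //.
  by rewrite invr_gt0 ltr0n/= invf_le1 ?ltr0n// ler1n.
move: cI; apply/negP; rewrite -leNgt.
pose e m z := expR (- m.+1%:R^-1 * ell z).
(* [g m] tends pointwise to the integrand of the information. As [w] and [f] both have integral 1,
   its own integral is (m + 1) (1 - mgf (1 / (m + 1))), at most c by the assumption to be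
   refuted. *)
pose g m z := m.+1%:R * (w z - w z * e m z) + f z.2 - w z.
have g0 m z : 0 <= g m z.
  (* With u = e^(- l / (m + 1)) one has f = w u^(m + 1), so that [g m] is w (u^(m + 1) - 1 - (m + 1)
     (u - 1)), nonnegative by Bernoulli's inequality. *)
  rewrite /g -expR_information_density.
  have -> : - ell z = m.+1%:R * (- m.+1%:R^-1 * ell z).
    by rewrite mulrA mulrN divff ?mulN1r// pnatr_eq0.
  rewrite expRM_natl -/(e m z).
  have := @bernoulli_ineq _ (e m z) m.+1 (expR_ge0 _).
  have := w_gt0 z; set u := e m z; set v := u ^+ _; set n := m.+1%:R; nra.
have me m := measurable_mgf_integrand m.+1%:R^-1.
have mg m : measurable_fun setT (g m).
  apply: measurable_funB => //; apply: measurable_funD => //.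
  apply: measurable_funM => //; apply: measurable_funB => //; exact: me.
have we0 m z : 0 <= w z * e m z by rewrite mulr_ge0 ?expR_ge0// ltW.
have intg m : (\int[p \x N]_z (g m z)%:E <= c%:E)%E.
  have w0 z : 0 <= w z by exact: ltW.
  have f0 z : 0 <= f z by exact: ltW.
  (* Written without subtraction, so that it is valid before the moment generating function is known
     to be finite; the finite right-hand side then excludes the infinite value. *)
  have : (\int[p \x N]_z (g m z)%:E +
      (m.+1%:R%:E * information_mgf N w p m.+1%:R^-1 + 1) = m.+1%:R%:E + 1)%E.
    have mwe : measurable_fun setT (fun z => m.+1%:R * (w z * e m z)).
      by apply: measurable_funM => //; exact: me.
    have -> : (m.+1%:R%:E * information_mgf N w p m.+1%:R^-1 + 1 =
        \int[p \x N]_z (m.+1%:R * (w z * e m z) + w z)%:E)%E.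
      rewrite ge0_integralD_real//; last by move=> z; rewrite mulr_ge0.
      by rewrite ge0_integralZl_real// ?integral_channel_density//; exact: me.
    have -> : (m.+1%:R%:E + 1 = \int[p \x N]_z (m.+1%:R * w z + f z.2)%:E)%E.
      rewrite ge0_integralD_real//; first last.
      - by move=> z; rewrite mulr_ge0.
      - exact: measurable_funM.
      rewrite ge0_integralZl_real// integral_channel_density mule1.
      by rewrite (ge0_integral_snd mf f0) integral_output_density.
    rewrite -ge0_integralD_real//; last 2 first.
      exact: measurable_funD.
      by move=> z; rewrite addr_ge0// mulr_ge0.
    by apply: eq_integral => z _; congr EFin; rewrite /g /e; ring.
  have : (0 <= \int[p \x N]_z (g m z)%:E)%E.
    by apply: integral_ge0 => z _; rewrite lee_fin.
  have := mgf_ge m; case: information_mgf => [r||]//; last first.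
    by move=> _; rewrite gt0_muley ?lte_fin// addye//; case: integral.
  case: integral => [q||]//.
  rewrite !lee_fin -EFinM -!EFinD => hr q0 [] hq.
  have : m.+1%:R * (1 - m.+1%:R^-1 * c) <= m.+1%:R * r by rewrite ler_wpM2l.
  rewrite mulrBr mulrA divff ?pnatr_eq0// mul1r mulr1; lra.
have -> : information N w p =
    (\int[p \x N]_z limn_einf (fun m => (g m z)%:E))%E.
  apply: eq_integral => z _; apply/esym.
  apply: (fst (cvg_limn_einf_sup _)).
  apply: cvg_EFin; first exact: nearW.
  rewrite (_ : fine \o _ = (fun m => w z *
    (m.+1%:R * (1 - expR (- (m.+1%:R^-1 * ell z)))) + f z.2 - w z)).
    apply: cvgB; last exact: cvg_cst.
    apply: cvgD; last exact: cvg_cst.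
    by apply: cvgM; [exact: cvg_cst|exact: cvg_expR_slope].
  by apply/funext => m /=; rewrite /g /e mulNr; ring.
apply: (le_trans (fatou _ _ _ _)) => //.
- by move=> m; apply/measurable_EFinP.
- by move=> m z _; rewrite lee_fin.
rewrite limn_einf_lim; apply: lime_le; first exact: is_cvg_einfs.
apply: nearW => m; apply: le_trans (intg m).
by apply: ereal_inf_lbound; exists m => //=.
Qed.

(** The information is at most the divergence of the joint law from [p \x N], that is the mean of ln
    w, and hence at most ln E[w] by Jensen. Both steps are contained in the pointwise bound l <= (w
    / t - 1) + ln t + (1 / f - 1), where w / t has mean at most 1 and 1 / f has mean 1 under the
    joint law. *)
Lemma information_le (t : R) : 1 <= t ->
  (\int[p \x N]_z (w z ^+ 2)%:E <= t%:E)%E -> (information N w p <= (ln t)%:E)%E.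
Proof.
move=> t1 w2t; have t0 : 0 < t by exact: lt_le_trans t1.
have w0 z : 0 <= w z by exact: ltW.
have f0 z : 0 <= f z by exact: ltW.
have mV : measurable_fun setT (fun y => (f y)^-1).
  rewrite (_ : (fun y => _) = expR \o (fun y => - ln (f y))).
    by apply: measurableT_comp => //; apply: measurable_funN;
      exact: measurableT_comp.
  by apply/funext => y /=; rewrite expRN lnK ?posrE.
have mV2 : measurable_fun setT (fun z : X * Y => (f z.2)^-1).
  exact: measurableT_comp mV measurable_snd.
have mw2 : measurable_fun setT (fun z => t^-1 * w z ^+ 2).
  by apply: measurable_funM => //; exact: measurable_funX.
have mwt : measurable_fun setT (fun z => ln t * w z) by exact: measurable_funM.
have mwf : measurable_fun setT (fun z => w z * (f z.2)^-1).
  exact: measurable_funM.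
have iwf : (\int[p \x N]_z (w z * (f z.2)^-1)%:E = 1)%E.
  rewrite (ge0_integral_output mV) => [|y]; last by rewrite invr_ge0.
  under eq_integral do rewrite divff ?gt_eqF//.
  exact: integral_cst_probability.
have w20 z : 0 <= t^-1 * w z ^+ 2 by rewrite mulr_ge0 ?invr_ge0 ?sqr_ge0 ?ltW.
have wt0 z : 0 <= ln t * w z by rewrite mulr_ge0 ?ln_ge0.
have wf0 z : 0 <= w z * (f z.2)^-1 by rewrite mulr_ge0 ?invr_ge0.
have mi := measurable_information_integrand.
have i0 := information_integrand_ge0.
(* The 3 compensates the [- w] of the integrand and the two [- 1] of the pointwise bound, leaving
   only nonnegative functions to integrate. *)
have : (information N w p + 3%:E * 1 <= t^-1%:E * t%:E + (ln t)%:E * 1 + 1 + 1)%E.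
  apply: (@le_trans _ _ (\int[p \x N]_z
      (t^-1 * w z ^+ 2 + ln t * w z + w z * (f z.2)^-1 + f z.2)%:E)%E); last first.
    have m12 := measurable_funD mw2 mwt.
    have m123 := measurable_funD m12 mwf.
    rewrite (ge0_integralD_real _ m123 mf2)//; last first.
      by move=> z; rewrite !addr_ge0.
    rewrite (ge0_integralD_real _ m12 mwf)//; last by move=> z; rewrite addr_ge0.
    rewrite ge0_integralD_real//.
    rewrite iwf (ge0_integral_snd mf f0) integral_output_density.
    rewrite (ge0_integralZl_real _ mw)// ?ln_ge0// integral_channel_density.
    rewrite !leeD2r// ge0_integralZl_real ?invr_ge0 ?(ltW t0)//.
    - by rewrite lee_wpmul2l// lee_fin invr_ge0 ltW.
    - exact: measurable_funX.
    - by move=> z; rewrite sqr_ge0.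
  rewrite -{1}integral_channel_density -ge0_integralZl_real//.
  rewrite /information -ge0_integralD_real//; last 2 first.
    exact: measurable_funM.
    by move=> z; rewrite mulr_ge0.
  apply: ge0_le_integral_real.
  - by apply: measurable_funD => //; exact: measurable_funM.
  - by do 3 apply: measurable_funD => //.
  - by move=> z; rewrite addr_ge0// mulr_ge0.
  move=> z.
  have lb : ell z <= (t^-1 * w z - 1) + ln t + ((f z.2)^-1 - 1).
    have ln_le (u : R) : 0 < u -> ln u <= u - 1.
      move=> u0; have u1 : -1 < u - 1 by lra.
      by have := le_ln1Dx u1; rewrite subrKC.
    have -> : ell z = ln (t^-1 * w z) + ln t + ln (f z.2)^-1.
      rewrite -!lnM ?posrE ?invr_gt0 ?mulr_gt0 ?invr_gt0//.
      by rewrite (_ : t^-1 * w z * t = w z)//; field; rewrite gt_eqF.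
    by rewrite !lerD// ln_le// ?mulr_gt0 ?invr_gt0.
  have := ler_wpM2l (w0 z) lb.
  set u := (f z.2)^-1; set v := t^-1; move=> h; lra.
rewrite !mule1 -EFinM mulVf ?gt_eqF// => h.
rewrite -(@leeD2rE _ 3%:E)//; apply: le_trans h _.
by rewrite -!EFinD lee_fin; lra.
Qed.

(* Fano's inequality up to the additive constant 2. *)
Lemma information_ge_codebook (M : nat) (c : 'I_M -> X) (dec : Y -> 'I_M) :
  (0 < M)%N -> (forall i, measurable (dec @^-1` [set i])) ->
  (forall g : X -> \bar R, measurable_fun setT g -> (forall x, 0 <= g x)%E ->
    (\int[p]_x g x = M%:R^-1%:E * \sum_(i < M) g (c i))%E) ->
  ((ln M%:R)%:E * (M%:R^-1%:E *
     \sum_(i < M) \int[N]_y (if dec y == i then w (c i, y) else 0)%:E)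
   <= information N w p + 2%:E)%E.
Proof.
move=> M0 mdec pE.
have MR0 : 0 < M%:R :> R by rewrite ltr0n.
have lnM0 : 0 <= ln M%:R :> R by rewrite ln_ge0// ler1n.
have w0 z : 0 <= w z by exact: ltW.
have f0 z : 0 <= f z by exact: ltW.
have mdecb i : measurable_fun setT (fun y => dec y == i).
  apply: (measurable_fun_bool true) => //; rewrite setTI.
  by rewrite (_ : _ @^-1` _ = dec @^-1` [set i])//; apply/seteqP; split => y /= /eqP.
(* Each y is decoded to exactly one message, so the sum of [h i y] over i is 2 M; averaged over the
   messages and integrated against [f], this gives the constant 2. *)
pose h i y : R := (if dec y == i then M%:R else 0) + 1.
have h0 i y : 0 <= h i y by rewrite /h; case: ifP => _; rewrite addr_ge0.
have mh i : measurable_fun setT (h i).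
  by apply: measurable_funD => //; exact: measurable_fun_ifT.
have mhf i : measurable_fun setT (fun y => h i y * f y) by exact: measurable_funM.
have hf0 i y : 0 <= h i y * f y by rewrite mulr_ge0.
have mwi i : measurable_fun setT (fun y => w (c i, y)) by exact: measurableT_comp.
have mdi i : measurable_fun setT (fun y => if dec y == i then w (c i, y) else 0).
  exact: measurable_fun_ifT.
have mi := measurable_information_integrand.
have i0 := information_integrand_ge0.
have mii i : measurable_fun setT
    (fun y => w (c i, y) * ell (c i, y) + f y - w (c i, y)).
  exact: (measurableT_comp mi (pair1_measurable _)).
have -> : (2%:E = M%:R^-1%:E * \sum_(i < M) \int[N]_y (h i y * f y)%:E)%E.
  rewrite -ge0_integral_sum//; last 2 first.
    by move=> i; exact/measurable_EFinP.
    by move=> i y _; rewrite lee_fin.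
  have sumh y : \sum_(i < M) h i y = 2 * M%:R.
    rewrite big_split/= sumr_const card_ord (bigD1 (dec y))//= eqxx.
    rewrite big1 ?addr0; first by rewrite mulr_natl mulr2n.
    by move=> i; rewrite eq_sym => /negbTE ->.
  under eq_integral do rewrite sumEFin -mulr_suml sumh.
  rewrite ge0_integralZl_real ?mulr_ge0 ?ltW// integral_output_density mule1.
  by rewrite -EFinM mulrCA mulVf ?mulr1// gt_eqF.
have -> : (information N w p = M%:R^-1%:E *
    \sum_(i < M) \int[N]_y (w (c i, y) * ell (c i, y) + f y - w (c i, y))%:E)%E.
  rewrite /information (fubini_tonelli1 (fun z => (w z * ell z + f z.2 - w z)%:E)).
  - rewrite pE//.
    + apply: measurable_fun_fubini_tonelli_F; first exact/measurable_EFinP.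
      by move=> z; rewrite lee_fin.
    + by move=> x; apply: integral_ge0 => y _; rewrite lee_fin i0.
  - exact/measurable_EFinP.
  - by move=> z; rewrite lee_fin.
rewrite -ge0_muleDr; last 2 first.
- by apply: sume_ge0 => i _; apply: integral_ge0 => y _; rewrite lee_fin (i0 (c i, y)).
- by apply: sume_ge0 => i _; apply: integral_ge0 => y _; rewrite lee_fin.
rewrite muleCA; apply: lee_wpmul2l; first by rewrite lee_fin invr_ge0 ltW.
rewrite -big_split/=.
rewrite ge0_sume_distrr; last first.
  by move=> i _; apply: integral_ge0 => y _; rewrite lee_fin; case: ifP.
apply: lee_sum => i _.
rewrite -ge0_integralZl_real//; last by move=> y; case: ifP.
rewrite -ge0_integralD_real//.
apply: ge0_le_integral_real.
- exact: measurable_funM.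
- exact: measurable_funD.
- by move=> y; rewrite mulr_ge0//; case: ifP.
move=> y; have := i0 (c i, y); rewrite /h /=; case: ifP => _; last first.
  by rewrite add0r mul1r mulr0; have := f0 y; lra.
move=> _; set v := w _; have v0 : 0 < v by exact: w_gt0.
(* This is e^u >= 1 + u at u = ln M - l, where e^u = M f / w. *)
have lb : ln M%:R + 1 - M%:R * f y / v <= ell (c i, y).
  have := @expR_ge1Dx R (ln M%:R - ell (c i, y)).
  rewrite expRD lnK ?posrE// /information_density expRN lnK ?posrE ?divr_gt0//=.
  by rewrite -/v invf_div mulrA; lra.
have := ler_wpM2l (ltW v0) lb.
have -> : v * (ln M%:R + 1 - M%:R * f y / v) = v * (ln M%:R + 1) - M%:R * f y.
  by field; rewrite gt_eqF.
by have := f0 y; lra.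
Qed.

(* Feinstein's greedy construction: codewords are added one at a time, the
   decoding region of a new codeword x being the set of outputs whose
   information density with x exceeds g and which satisfy no earlier test. *)
Lemma feinstein (S : set X) (s g eps : R) (M : nat) :
  0 <= s -> p S = 1%E -> measurable S ->
  ((expR (s * g))%:E * information_mgf N w p s + (M%:R * expR (- g))%:E
    < eps%:E)%E ->
  exists2 x : nat -> X, (forall i, (i < M)%N -> S (x i)) &
    forall i, (i < M)%N -> ((1 - eps)%:E <=
      \int[N]_y (if (g < ell (x i, y)) &&
                    ~~ has (fun j => g < ell (x j, y)) (iota 0 i)
                 then w (x i, y) else 0)%:E)%E.
Proof.
move=> s0 pS mS epsb.
have w0 z : 0 <= w z by exact: ltW.
have f0 y : 0 <= f y by exact: ltW.
have mhit x : measurable_fun setT (fun y => g < ell (x, y)).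
  by apply: measurable_fun_ltr => //; exact: (measurableT_comp ml (pair1_measurable _)).
have mhas (x : nat -> X) r :
    measurable_fun setT (fun y => has (fun j => g < ell (x j, y)) r).
  elim: r => [|j r IH] /=; first exact: measurable_cst.
  exact: measurable_or.
have [x0 Sx0] : S !=set0.
  apply/set0P/eqP => S0; move: pS.
  by rewrite S0 measure0 => /eqP; rewrite eq_sym onee_eq0.
suff H m : (m <= M)%N -> exists2 x : nat -> X, (forall i, S (x i)) &
    forall i, (i < m)%N -> ((1 - eps)%:E <=
      \int[N]_y (if (g < ell (x i, y)) &&
                    ~~ has (fun j => g < ell (x j, y)) (iota 0 i)
                 then w (x i, y) else 0)%:E)%E.
  by have [x Sx xP] := H _ (leqnn M); exists x.
elim: m => [|m IH] mM; first by exists (fun=> x0).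
have [x Sx xP] := IH (ltnW mM).
pose D y := has (fun j => g < ell (x j, y)) (iota 0 m).
(* Probability that the candidate codeword u is decoded correctly after the m chosen ones, [D] being
   the region that they claim. If every u in S fails, averaging over [p] leads to a
   contradiction. *)
pose W u := (\int[N]_y (if (g < ell (u, y)) && ~~ D y then w (u, y) else 0)%:E)%E.
suff [u [Su Wu]] : exists u, S u /\ ((1 - eps)%:E <= W u)%E.
  pose x' i := if i == m then u else x i.
  have Dx' i y : (i <= m)%N -> has (fun j => g < ell (x' j, y)) (iota 0 i) =
      has (fun j => g < ell (x j, y)) (iota 0 i).
    move=> im; apply: eq_in_has => j; rewrite mem_iota add0n => /andP[_ ji].
    by rewrite /x' ltn_eqF// (leq_trans ji).
  exists x' => [i|i]; first by rewrite /x'; case: ifP.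
  rewrite ltnS leq_eqVlt => /predU1P[->|im].
    rewrite (le_trans Wu)// le_eqVlt; apply/orP; left; apply/eqP.
    by apply: eq_integral => y _; rewrite Dx'// /x' eqxx.
  rewrite (le_trans (xP _ im))// le_eqVlt; apply/orP; left; apply/eqP.
  by apply: eq_integral => y _; rewrite (Dx' _ _ (ltnW im)) /x' ltn_eqF.
apply: contrapT => noU.
have WS u : S u -> (W u < (1 - eps)%:E)%E.
  by move=> Su; rewrite ltNge; apply/negP => h; apply: noU; exists u.
have mhit2 : measurable_fun setT (fun z : X * Y => g < ell z).
  exact: measurable_fun_ltr.
have mD : measurable_fun setT D by exact: mhas.
have mD2 : measurable_fun setT (fun z : X * Y => D z.2) by exact: measurableT_comp.
(* Pointwise w <= a + b + w e: either the test succeeds on an unclaimed output, or l <= g and e^(s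
   (g - l)) >= 1, or the output is claimed. The three integrals sum to less than 1, although [w] has
   integral 1. *)
pose a z := if (g < ell z) && ~~ D z.2 then w z else 0.
pose b z := expR (s * g) * (w z * expR (- s * ell z)).
pose e y : R := if D y then 1 else 0.
have ma : measurable_fun setT a.
  apply: measurable_fun_ifT => //; apply: measurable_and => //.
  exact: measurable_neg.
have mmgf := measurable_mgf_integrand s.
have mb : measurable_fun setT b by exact: measurable_funM.
have me : measurable_fun setT e by exact: measurable_fun_ifT.
have me2 : measurable_fun setT (fun z : X * Y => w z * e z.2).
  by apply: measurable_funM => //; exact: measurableT_comp.
have a0 z : 0 <= a z by rewrite /a; case: ifP.
have b0 z : 0 <= b z by rewrite !mulr_ge0 ?expR_ge0.
have e0 y : 0 <= e y by rewrite /e; case: ifP.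
have we0 z : 0 <= w z * e z.2 by rewrite mulr_ge0.
have ia : (\int[p \x N]_z (a z)%:E <= (1 - eps)%:E)%E.
  have mEa : measurable_fun setT (EFin \o a) by exact/measurable_EFinP.
  have Ea0 z : (0 <= (EFin \o a) z)%E by rewrite lee_fin.
  rewrite (fubini_tonelli1 (EFin \o a))//.
  have W0 u : (0 <= W u)%E.
    by apply: integral_ge0 => y _; rewrite lee_fin; case: ifP.
  have eps1 : 0 <= 1 - eps.
    by rewrite -lee_fin (le_trans (W0 x0))// ltW// WS.
  rewrite -(integral_cst_probability p (1 - eps)%:E).
  apply: ae_ge0_le_integral => //.
  - exact: measurable_fun_fubini_tonelli_F.
  - exists (~` S); split; first exact: measurableC.
      transitivity (1 - p S)%E; first exact: probability_setC.
      by rewrite pS subee.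
    move=> u /=; apply: contra_not => Su _; exact/ltW/WS.
have ib : (\int[p \x N]_z (b z)%:E =
    (expR (s * g))%:E * information_mgf N w p s)%E.
  rewrite ge0_integralZl_real ?expR_ge0// => z.
  by rewrite mulr_ge0 ?expR_ge0.
(* Union bound: if y is claimed by codeword j, then f y = w e^(- l) <= e^(- g) w (x j, y), and each
   w (x j, .) has integral 1. *)
have ie : (\int[p \x N]_z (w z * e z.2)%:E <= (M%:R * expR (- g))%:E)%E.
  rewrite ge0_integral_output//.
  have mwx j : measurable_fun setT (fun y => w (x j, y)) by exact: measurableT_comp.
  apply: (@le_trans _ _ (\int[N]_y
      (expR (- g) * \sum_(j <- iota 0 m) w (x j, y))%:E)%E).
    apply: ge0_le_integral_real => //.
    - exact: measurable_funM.
    - by apply: measurable_funM => //; exact: measurable_sum.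
    - by move=> y; rewrite mulr_ge0.
    move=> y; rewrite /e; case: ifPn => [/hasP[j jm gl]|_]; last first.
      by rewrite mulr0 mulr_ge0 ?expR_ge0 ?sumr_ge0.
    rewrite mulr1 (big_rem j)//= mulrDr.
    rewrite (@le_trans _ _ (expR (- g) * w (x j, y)))//; last first.
      by rewrite lerDl mulr_ge0 ?expR_ge0 ?sumr_ge0.
    rewrite -(expR_information_density (x j, y)) mulrC ler_pM2r//.
    by rewrite ler_expR lerN2 ltW.
  rewrite ge0_integralZl_real ?expR_ge0//; last 2 first.
  - exact: measurable_sum.
  - by move=> y; rewrite sumr_ge0.
  under eq_integral do rewrite -sumEFin.
  rewrite ge0_integral_sum//; last 2 first.
  - by move=> j; exact/measurable_EFinP.
  - by move=> j y _; rewrite lee_fin.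
  under eq_bigr do rewrite w1.
  rewrite sumEFin big_const_seq iter_addr_0 count_predT size_iota -EFinM.
  by rewrite lee_fin mulrC ler_wpM2r ?expR_ge0// ler_nat ltnW.
have : (1 <= \int[p \x N]_z (a z + b z + w z * e z.2)%:E)%E.
  rewrite -integral_channel_density; apply: ge0_le_integral_real => //.
    by do 2 apply: measurable_funD => //.
  move=> z; rewrite /a; case: ifPn => [_|].
    by rewrite -addrA lerDl; exact: (addr_ge0 (b0 z) (we0 z)).
  rewrite negb_and negbK -leNgt add0r => /orP[lg|Dz]; last first.
    by rewrite /e Dz mulr1 lerDr; exact: b0.
  rewrite -[leLHS]addr0 lerD//.
  rewrite /b mulrCA -expRD ler_peMr// -[leLHS]expR0 ler_expR.
  by rewrite mulNr subr_ge0 ler_wpM2l.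
have mab : measurable_fun setT (fun z => a z + b z) by exact: measurable_funD.
rewrite (ge0_integralD_real _ mab me2)//; last by move=> z; rewrite addr_ge0.
rewrite ge0_integralD_real// ib; apply/negP; rewrite -ltNge.
rewrite (@le_lt_trans _ _ ((1 - eps)%:E +
  ((expR (s * g))%:E * information_mgf N w p s + (M%:R * expR (- g))%:E))%E)//.
  by rewrite -addeA leeD// leeD2l.
by rewrite (@lt_le_trans _ _ ((1 - eps)%:E + eps%:E)%E)// ?lteD2lE// -EFinD subrK.
Qed.

(** [J] has density e^l = w / f with respect to [PX \x PY]. Its divergence is the mean of l, which
    is well defined because the negative part of l is at most e^(- l), of mean 1; adding e^(- l) -
    1, of mean 0, turns it into the nonnegative integral [information]. *)
Lemma kl_divergence_information (J : probability (X * Y)%type R)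
    (PX : probability X R) (PY : probability Y R) :
  (forall A, measurable A -> PX A = p A) ->
  (forall h : X * Y -> R, measurable_fun setT h -> (forall z, 0 <= h z) ->
    (\int[J]_z (h z)%:E = \int[p \x N]_z (w z * h z)%:E)%E) ->
  (forall A, measurable A -> (PY A = \int[N]_(y in A) (f y)%:E)%E) ->
  kl_divergence J (PX \x PY)%E = information N w p.
Proof.
move=> PXE JE PYE.
have w0 z : 0 <= w z by exact: ltW.
have f0 y : 0 <= f y by exact: ltW.
have mexp : measurable_fun setT (fun z => expR (ell z)) by exact: measurableT_comp.
rewrite (@kl_divergence_density _ _ _ J (PX \x PY)%E (fun z => expR (ell z)))//; last 2 first.
- by move=> z; exact: expR_gt0.
- move=> A mA.
  have mA1 : measurable_fun setT (\1_A : X * Y -> R) by exact: measurable_indic.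
  transitivity (\int[J]_z (\1_A z)%:E)%E; first by rewrite integral_indic// setIT.
  rewrite JE//.
  transitivity (\int[PX \x PY]_z (expR (ell z) * \1_A z)%:E)%E; last first.
    rewrite [RHS]integral_mkcond; apply: eq_integral => z _.
    rewrite patchE indicE; case: ifPn => zA; by rewrite ?mulr1 ?mulr0.
  have meA : measurable_fun setT (fun z => expR (ell z) * \1_A z).
    exact: measurable_funM.
  have mwA : measurable_fun setT (fun z => w z * \1_A z) by exact: measurable_funM.
  rewrite (fubini_tonelli1 (fun z => (w z * \1_A z)%:E)); last 2 first.
    exact/measurable_EFinP.
    by move=> z; rewrite lee_fin mulr_ge0.
  rewrite (fubini_tonelli1 (fun z => (expR (ell z) * \1_A z)%:E)); last 2 first.
    exact/measurable_EFinP.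
    by move=> z; rewrite lee_fin mulr_ge0 ?expR_ge0.
  rewrite [RHS](eq_measure_integral p); last by move=> C mC _; exact: PXE.
  apply: eq_integral => x _; rewrite /fubini_F.
  rewrite [RHS](ge0_integral_density mf f0 PYE); last 2 first.
    by apply/measurable_EFinP; exact: (measurableT_comp meA (pair1_measurable _)).
    by move=> y; rewrite lee_fin mulr_ge0 ?expR_ge0.
  apply: eq_integral => y _; rewrite -EFinM; congr EFin.
  rewrite /information_density lnK ?posrE ?divr_gt0//= mulrAC divfK//.
  by rewrite gt_eqF.
under eq_integral do rewrite expRK.
pose a z := Num.max (ell z) 0.
pose b z := Num.max (- ell z) 0.
have a0 z : 0 <= a z by rewrite le_max lexx orbT.
have b0 z : 0 <= b z by rewrite le_max lexx orbT.
have ma : measurable_fun setT a by exact: measurable_maxr.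
have mb : measurable_fun setT b.
  by apply: measurable_maxr => //; exact: measurable_funN.
rewrite integralE.
have -> : (fun z => (ell z)%:E)^\+%E = (fun z => (a z)%:E).
  by apply/funext => z; rewrite funeposE EFin_max.
have -> : (fun z => (ell z)%:E)^\-%E = (fun z => (b z)%:E).
  by apply/funext => z; rewrite funenegE EFin_max.
have mu : measurable_fun setT (fun z => expR (- ell z)).
  by apply: measurableT_comp => //; exact: measurable_funN.
have iu : (\int[J]_z (expR (- ell z))%:E = 1)%E.
  rewrite JE//.
  under eq_integral do rewrite expR_information_density.
  by rewrite (ge0_integral_snd mf f0) integral_output_density.
have ib : (\int[J]_z (b z)%:E <= 1)%E.
  rewrite -iu; apply: ge0_le_integral_real => // z.
  by rewrite ge_max expR_ge0 andbT; have := expR_ge1Dx (- ell z); lra.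
pose c z := ell z + expR (- ell z) - 1.
have c0 z : 0 <= c z by rewrite /c; have := expR_ge1Dx (- ell z); lra.
have mc : measurable_fun setT c.
  by apply: measurable_funB => //; exact: measurable_funD.
have ic : (\int[J]_z (c z)%:E = information N w p)%E.
  rewrite JE//; apply: eq_integral => z _.
  by rewrite -expR_information_density; congr EFin; rewrite /c; ring.
(* The identity a - b = l, rearranged so that both sides are sums of nonnegative functions; only the
   integrals of [a] and [c] can be infinite, and then both are. *)
have : (\int[J]_z (a z + expR (- ell z))%:E = \int[J]_z (c z + b z + 1)%:E)%E.
  apply: eq_integral => z _; congr EFin.
  by rewrite /a /b /c /Num.max; do ?case: ifP; lra.
rewrite ge0_integralD_real//.
rewrite iu (ge0_integralD_real _ (measurable_funD mc mb))//; last first.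
  by move=> z; rewrite addr_ge0.
rewrite integral_cst_probability ge0_integralD_real// ic.
have : (0 <= \int[J]_z (b z)%:E)%E by apply: integral_ge0 => z _; rewrite lee_fin.
case: (integral J _ (fun z => (b z)%:E)) ib => [r||]// _ _ h.
by move: h; case: (integral J _ _) => [q||]; case: (information _ _ _) => [q'||]//=;
  move=> [] h; congr EFin; lra.
Qed.

End channel.

(** * Translates of Gaussian noise *)

Section normal_translation.
Local Open Scope ereal_scope.
Context (R : realType).
Local Notation mu := (@lebesgue_measure R).

(** Lebesgue measure is determined by its values on half-open intervals, whose length a shift
    preserves. *)
Lemma lebesgue_measure_translation (a : R) (A : set R) : measurable A ->
  pushforward mu (fun z : R => (a + z)%R : measurableTypeR R) A = mu A.
Proof.
have ma : measurable_fun setT (fun z : R => (a + z)%R : measurableTypeR R).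
  exact: measurable_funD.
pose M := isMeasurableFun.Build _ _ _ _ _ ma.
pose F : {mfun R >-> measurableTypeR R} :=
  HB.pack (fun z : R => (a + z)%R : measurableTypeR R) M.
move=> mA; apply/esym.
apply: (lebesgue_measure_unique (mu := pushforward mu F)) => //= _ [[b c]] _ <-.
rewrite /pushforward (_ : _ @^-1` _ = `](b - a)%R, (c - a)%R]%classic).
  rewrite !lebesgue_measure_itv/= !lte_fin ltrD2r.
  by rewrite -!EFinB; case: ifP => // _; congr EFin; ring.
by apply/seteqP; split => z /=; rewrite !in_itv/= ltrBlDl lerBrDl.
Qed.

Lemma ge0_integral_lebesgue_translation (a : R) (h : R -> \bar R) :
  measurable_fun setT h -> (forall x, 0 <= h x) ->
  \int[mu]_x h (a + x)%R = \int[mu]_x h x.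
Proof.
move=> mh h0.
have ma : @measurable_fun _ _ (measurableTypeR R) (measurableTypeR R) setT
    (fun z : R => (a + z)%R).
  exact: measurable_funD.
have := ge0_integral_pushforward ma mu measurableT mh (fun x _ => h0 x).
rewrite preimage_setT => <-.
apply: eq_measure_integral => A mA _.
exact: lebesgue_measure_translation.
Qed.

(** The Cameron-Martin formula in dimension one: after the substitution y = a + x, completing the
    square turns the density at a + x, times the exponential weight, into the density at x. *)
Lemma ge0_integral_normal_translation (s a : R) (g : measurableTypeR R -> \bar R) :
  s != 0%R -> measurable_fun setT g -> (forall x, 0 <= g x) ->
  \int[normal_prob 0 s]_z g (a + z)%R =
  \int[normal_prob 0 s]_y (g y * (expR ((a * y - a ^+ 2 / 2) / s ^+ 2))%:E).
Proof.
move=> s0 mg g0.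
have pdfE A : measurable A ->
  normal_prob 0 s A = \int[mu]_(x in A) (normal_pdf 0 s x)%:E by [].
have mpdf := measurable_normal_pdf 0%R s.
have pdf0 := normal_pdf_ge0 0%R s.
have ma : measurable_fun setT (fun z : R => (a + z)%R) by exact: measurable_funD.
have me : measurable_fun setT
    (fun y : R => expR ((a * y - a ^+ 2 / 2) / s ^+ 2)).
  apply: measurableT_comp => //; apply: measurable_funM => //.
  by apply: measurable_funB => //; exact: measurable_funM.
have dens := @ge0_integral_density _ (measurableTypeR R) R mu (normal_prob 0 s)
  _ _ mpdf pdf0 pdfE.
rewrite dens//; last exact: measurableT_comp.
rewrite dens//; last 2 first.
- by apply: emeasurable_funM => //; exact/measurable_EFinP.
- by move=> x; rewrite mule_ge0 ?lee_fin ?expR_ge0.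
rewrite -[RHS](ge0_integral_lebesgue_translation a); last 2 first.
- apply: emeasurable_funM; last exact/measurable_EFinP.
  by apply: emeasurable_funM => //; exact/measurable_EFinP.
- by move=> x; rewrite !mule_ge0 ?lee_fin ?expR_ge0.
apply: eq_integral => x _; rewrite -muleA; congr (_ * _).
rewrite -EFinM !normal_pdfE//; congr EFin.
rewrite /normal_fun mulrCA -expRD; congr (_ * expR _)%R.
by field.
Qed.

End normal_translation.

(** * Vectors, product noise and the Gaussian channel density *)

Section vectors.
Context (R : realType).

Lemma measurable_coord n (i : 'I_n) :
  measurable_fun setT (fun x : Rn R n => tnth x i : R).
Proof. exact: (@measurable_tnth _ (measurableTypeR R)). Qed.

Lemma measurable_consv n :
  measurable_fun setT (fun ax : measurableTypeR R * Rn R n => tuple_cons ax).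
Proof. exact: measurable_tuple_cons. Qed.

Definition catv m n (ab : Rn R m * Rn R n) : Rn R (m + n) :=
  [tuple of ab.1 ++ ab.2].

Lemma catv_cons m n (a : measurableTypeR R) (x : Rn R m) (y : Rn R n) :
  catv (tuple_cons (a, x), y) = tuple_cons (a, catv (x, y)).
Proof. exact: val_inj. Qed.

Lemma measurable_catv m n : measurable_fun setT (@catv m n).
Proof.
apply/measurable_fun_tnthP => i; case: (splitP i) => j ij.
  rewrite (_ : _ \o _ = (fun ab => tnth ab.1 j)).
    exact: (measurableT_comp (measurable_coord j) measurable_fst).
  apply/funext => ab /=; rewrite -(tnth_lshift ab.1 ab.2).
  by congr (tnth _ _); exact: val_inj.
rewrite (_ : _ \o _ = (fun ab => tnth ab.2 j)).
  exact: (measurableT_comp (measurable_coord j) measurable_snd).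
apply/funext => ab /=; rewrite -(tnth_rshift ab.1 ab.2).
by congr (tnth _ _); exact: val_inj.
Qed.

HB.instance Definition _ m n :=
  isMeasurableFun.Build _ _ _ _ (@catv m n) (@measurable_catv m n).

Lemma addv_cons n (a b : measurableTypeR R) (x y : Rn R n) :
  addv (tuple_cons (a, x)) (tuple_cons (b, y)) =
  tuple_cons ((a : R) + b, addv x y).
Proof.
apply: eq_from_tnth => i; rewrite tnth_mktuple /tuple_cons/=.
case: (unliftP ord0 i) => [j|] ->; rewrite ?tnth0 ?tnthS ?tnth_mktuple//.
Qed.

End vectors.

Section noise.
Local Open Scope ereal_scope.
Context (R : realType) (nu : R).

Lemma ge0_integral_noise_cons n (g : Rn R n.+1 -> \bar R) :
  measurable_fun setT g -> (forall z, 0 <= g z) ->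
  \int[noise_law nu n.+1]_z g z =
  \int[normal_prob 0 (Num.sqrt nu)]_a \int[noise_law nu n]_t g (tuple_cons (a, t)).
Proof.
move=> mg g0; rewrite /noise_law/= ge0_integral_distribution//.
rewrite (fubini_tonelli1 (g \o @tuple_cons _ (measurableTypeR R) n))//.
- exact: (measurableT_comp mg (@measurable_consv R _)).
- by move=> z; exact: g0.
Qed.

Lemma ge0_integral_noise_cat m n (g : Rn R (m + n) -> \bar R) :
  measurable_fun setT g -> (forall z, 0 <= g z) ->
  \int[noise_law nu (m + n)]_z g z =
  \int[noise_law nu m]_a \int[noise_law nu n]_b g (catv (a, b)).
Proof.
elim: m g => [|m IH] g mg g0.
  rewrite [RHS]integral_dirac//.
    rewrite diracT mul1e; apply: eq_integral => z _; congr g; exact: val_inj.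
  apply: (@measurable_fun_fubini_tonelli_F _ _ _ _ _ (noise_law nu n) (g \o @catv R 0 n)).
    exact: (measurableT_comp mg (@measurable_catv R 0 n)).
  by move=> z; exact: g0.
rewrite (@ge0_integral_noise_cons (m + n))// ge0_integral_noise_cons; last 2 first.
- apply: (@measurable_fun_fubini_tonelli_F _ _ _ _ _ (noise_law nu n) (g \o @catv R m.+1 n)).
    exact: (measurableT_comp mg (@measurable_catv R m.+1 n)).
  by move=> z; exact: g0.
- by move=> z; apply: integral_ge0 => b _; exact: g0.
apply: eq_integral => a _; rewrite IH.
- by do 2 (apply: eq_integral => ? _); rewrite -catv_cons.
- apply: (measurableT_comp mg).
  exact: (measurableT_comp (@measurable_consv R _) (pair1_measurable a)).
- by move=> z; exact: g0.
Qed.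

End noise.

Section awgn_density.
Context (R : realType) (nu : R).

(* The density of the law of x + Z with respect to the law of Z. *)
Definition awgn_density n (xy : Rn R n * Rn R n) : R :=
  expR ((\sum_(i < n) ((tnth xy.1 i : R) * tnth xy.2 i
                       - (tnth xy.1 i : R) ^+ 2 / 2)) / nu).

Lemma awgn_density_gt0 n xy : 0 < @awgn_density n xy.
Proof. exact: expR_gt0. Qed.

Lemma measurable_awgn_density n : measurable_fun setT (@awgn_density n).
Proof.
apply: measurableT_comp => //; apply: measurable_funM => //.
apply: measurable_sum => i.
have m1 : measurable_fun setT (fun xy : Rn R n * Rn R n => tnth xy.1 i : R).
  exact: (measurableT_comp (measurable_coord i) measurable_fst).
have m2 : measurable_fun setT (fun xy : Rn R n * Rn R n => tnth xy.2 i : R).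
  exact: (measurableT_comp (measurable_coord i) measurable_snd).
apply: measurable_funB; first exact: measurable_funM.
by apply: measurable_funM => //; exact: measurable_funX.
Qed.

Lemma awgn_density_cons n (a b : measurableTypeR R) (x y : Rn R n) :
  awgn_density (tuple_cons (a, x), tuple_cons (b, y)) =
  expR (((a : R) * b - (a : R) ^+ 2 / 2) / nu) * awgn_density (x, y).
Proof.
rewrite /awgn_density /tuple_cons/= big_ord_recl mulrDl expRD !tnth0.
congr (_ * expR (_ / nu)); apply: eq_bigr => i _.
by rewrite !tnthS.
Qed.

Lemma awgn_density_cat m n (x1 y1 : Rn R m) (x2 y2 : Rn R n) :
  awgn_density (catv (x1, x2), catv (y1, y2)) =
  awgn_density (x1, y1) * awgn_density (x2, y2).
Proof.
rewrite /awgn_density/= big_split_ord mulrDl expRD.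
under eq_bigr do rewrite !tnth_lshift.
by under [X in _ * expR (X / _)]eq_bigr do rewrite !tnth_rshift.
Qed.

Hypothesis nu_gt0 : 0 < nu.

(** From (a - b)^2 >= 0 in each coordinate. The bound, free of x, is the [B] required of a channel
    with a density. *)
Lemma awgn_density_le n (x y : Rn R n) :
  awgn_density (x, y) <= expR ((\sum_(i < n) (tnth y i : R) ^+ 2 / 2) / nu).
Proof.
rewrite ler_expR ler_pM2r ?invr_gt0//; apply: ler_sum => i _ /=.
set a := tnth x i; set b := tnth y i.
by have := sqr_ge0 ((a : R) - b); nra.
Qed.

Lemma ge0_integral_awgn n (x : Rn R n) (g : Rn R n -> \bar R) :
  measurable_fun setT g -> (forall y, 0 <= g y)%E ->
  (\int[noise_law nu n]_z g (addv x z) =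
   \int[noise_law nu n]_y (g y * (awgn_density (x, y))%:E))%E.
Proof.
elim: n x g => [|n IH] x g mg g0.
  apply: eq_integral => z _.
  rewrite /awgn_density big_ord0 mul0r expR0 mule1; congr g.
  by rewrite (tuple0 z); exact: tuple0.
pose a := thead x; pose x' : Rn R n := behead_tuple x.
have xE : x = tuple_cons (a, x') by rewrite [LHS]tuple_eta.
have mgc : measurable_fun setT (g \o @tuple_cons _ (measurableTypeR R) n).
  exact: (measurableT_comp mg (@measurable_consv R _)).
have mw1 : measurable_fun setT (fun y => awgn_density (x', y)).
  exact: (measurableT_comp (@measurable_awgn_density n) (pair1_measurable _)).
have mw2 : measurable_fun setT (fun y => awgn_density (x, y)).
  exact: (measurableT_comp (@measurable_awgn_density n.+1) (pair1_measurable _)).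
have madd : measurable_fun setT (fun z => addv x z).
  exact: (measurableT_comp (@measurable_channel_output R n.+1) (pair1_measurable x)).
rewrite ge0_integral_noise_cons//; last exact: (measurableT_comp mg madd).
rewrite ge0_integral_noise_cons; last 2 first.
- by apply: emeasurable_funM => //; exact/measurable_EFinP.
- by move=> z; rewrite mule_ge0// lee_fin ltW// awgn_density_gt0.
(* The induction hypothesis shifts all coordinates but the first; [Phi] integrates them out, and the
   one-dimensional formula applied to [Phi] shifts the first. *)
pose Phi u := (\int[noise_law nu n]_y
   (g (tuple_cons (u, y)) * (awgn_density (x', y))%:E))%E.
transitivity (\int[normal_prob 0 (Num.sqrt nu)]_b Phi ((a : R) + b)%R)%E.
  apply: eq_integral => b _; rewrite /Phi -IH; last 2 first.
  - exact: (measurableT_comp mgc (pair1_measurable _)).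
  - by move=> y; exact: g0.
  by apply: eq_integral => t _; rewrite xE addv_cons.
have gw0 u y : (0 <= g (tuple_cons (u, y)) * (awgn_density (x', y))%:E)%E.
  by rewrite mule_ge0// lee_fin ltW// awgn_density_gt0.
have mgw : measurable_fun setT (fun uy : measurableTypeR R * Rn R n =>
    g (tuple_cons uy) * (awgn_density (x', uy.2))%:E)%E.
  apply: emeasurable_funM; first exact: mgc.
  by apply/measurable_EFinP; exact: (measurableT_comp mw1 measurable_snd).
have mPhi : measurable_fun setT Phi.
  by apply: (measurable_fun_fubini_tonelli_F _ mgw) => -[u y]; exact: gw0.
have Phi0 u : (0 <= Phi u)%E by apply: integral_ge0 => y _; exact: gw0.
have s0 : Num.sqrt nu != 0 by rewrite gt_eqF// sqrtr_gt0.
apply: etrans (ge0_integral_normal_translation a s0 mPhi Phi0) _.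
apply: eq_integral => u _.
have mgwu : measurable_fun setT
    (fun y => g (tuple_cons (u, y)) * (awgn_density (x', y))%:E)%E.
  exact: (measurableT_comp mgw (pair1_measurable u)).
rewrite /Phi -(ge0_integralZr _ measurableT mgwu (fun y _ => gw0 u y))//.
apply: eq_integral => y _; rewrite -muleA -EFinM xE awgn_density_cons.
by rewrite sqr_sqrtr ?ltW// mulrC.
Qed.

Lemma integral_awgn_density n (x : Rn R n) :
  (\int[noise_law nu n]_y (awgn_density (x, y))%:E = 1)%E.
Proof.
have := @ge0_integral_awgn n x (cst 1%E) (measurable_cst _) (fun=> lee01).
rewrite integral_cst_probability => ->.
by apply: eq_integral => y _; rewrite mul1e.
Qed.

(** Since w (x, y)^2 = e^(|x|^2 / nu) w (2 x, y), the normalisation of the density at 2 x gives the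
    value. *)
Lemma integral_awgn_density_sqr n (x : Rn R n) :
  (\int[noise_law nu n]_y (awgn_density (x, y) ^+ 2)%:E =
   (expR ((\sum_(i < n) (tnth x i : R) ^+ 2) / nu))%:E)%E.
Proof.
rewrite -[RHS]mule1 -(integral_awgn_density (addv x x)).
have mw : measurable_fun setT (fun y => awgn_density (addv x x, y)).
  exact: (measurableT_comp (@measurable_awgn_density n) (pair1_measurable _)).
have w0 y : 0 <= awgn_density (addv x x, y) by exact/ltW/awgn_density_gt0.
rewrite -(ge0_integralZl_real _ mw (expR_ge0 _) w0).
apply: eq_integral => y _; congr EFin.
rewrite /awgn_density -expRM_natl -expRD -mulrDl mulrA; congr (expR (_ / nu)).
rewrite mulr_sumr -big_split/=; apply: eq_bigr => i _.
by rewrite tnth_mktuple; field.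
Qed.

Lemma channel_information_density n (p : probability (Rn R n) R) :
  channel_information nu p =
  information (noise_law nu n) (@awgn_density n) p.
Proof.
have mw := @measurable_awgn_density n.
have w0 (xy : Rn R n * Rn R n) : 0 <= awgn_density xy by exact/ltW/awgn_density_gt0.
(* For fixed x the output has density w (x, .) with respect to the noise; this identifies the joint
   law and, with h depending on y alone, the output law. *)
have shift (h : Rn R n * Rn R n -> R) : measurable_fun setT h ->
    (forall z, 0 <= h z) ->
    (\int[p \x noise_law nu n]_xz (h (xz.1, addv xz.1 xz.2))%:E =
     \int[p \x noise_law nu n]_z (awgn_density z * h z)%:E)%E.
  move=> mh h0.
  rewrite (fubini_tonelli1 (fun xz => (h (xz.1, addv xz.1 xz.2))%:E)); last 2 first.
  - apply/measurable_EFinP; apply: (measurableT_comp mh).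
    apply: measurable_fun_pair; first exact: measurable_fst.
    exact: measurable_channel_output.
  - by move=> z; rewrite lee_fin.
  rewrite (fubini_tonelli1 (fun z => (awgn_density z * h z)%:E)); last 2 first.
  - by apply/measurable_EFinP; exact: measurable_funM.
  - by move=> z; rewrite lee_fin mulr_ge0.
  apply: eq_integral => x _; rewrite /fubini_F/=.
  rewrite (ge0_integral_awgn x (g := fun y => (h (x, y))%:E)).
  - by apply: eq_integral => y _; rewrite -EFinM mulrC.
  - by apply/measurable_EFinP; exact: (measurableT_comp mh (pair1_measurable _)).
  - by move=> y; rewrite lee_fin.
rewrite /channel_information /mutual_information.
apply: (kl_divergence_information mw (@awgn_density_gt0 n) (@awgn_density_le n)
  (@integral_awgn_density n)).
- move=> A mA.
  rewrite -[LHS]/((p \x noise_law nu n)%E (fst @^-1` A)).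
  rewrite (_ : fst @^-1` A = A `*` setT); last first.
    by apply/seteqP; split => -[x z] //= [].
  rewrite product_measure1E// -[RHS]mule1; congr (_ * _)%E.
  exact: probability_setT.
- move=> h mh h0; rewrite ge0_integral_distribution//.
  + exact: shift.
  + exact/measurable_EFinP.
- move=> A mA.
  have mA1 : measurable_fun setT (\1_A : Rn R n -> R) by exact: measurable_indic.
  transitivity (\int[distribution (p \x noise_law nu n)%E (@channel_output R n)]_y
      (\1_A y)%:E)%E; first by rewrite integral_indic// setIT.
  rewrite ge0_integral_distribution//; last exact/measurable_EFinP.
  transitivity (\int[p \x noise_law nu n]_z (awgn_density z * \1_A z.2)%:E)%E.
    apply: (shift (fun z => \1_A z.2)) => //; exact: measurableT_comp.
  rewrite (ge0_integral_output (noise_law nu n) mw (@awgn_density_gt0 n) (@awgn_density_le n))//.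
  rewrite [RHS]integral_mkcond; apply: eq_integral => y _.
  by rewrite patchE indicE; case: ifPn => yA; rewrite ?mulr1 ?mulr0.
Qed.

End awgn_density.

(** * Concatenation of admissible blocks *)

Section power_constraint.
Context (R : realType) (sigma rho : R).
Hypotheses (sigma_ge0 : 0 <= sigma) (rho_ge0 : 0 <= rho).

Lemma measurable_power_constrained n :
  measurable (power_constrained n sigma rho).
Proof.
rewrite (_ : power_constrained n sigma rho =
  \bigcap_k \bigcap_l [set x : Rn R n | (k < l <= n)%N ->
    \sum_(j < n | (k <= j < l)%N) (tnth x j : R) ^+ 2
      <= sigma + (l - k)%:R * rho]); last first.
  by apply/seteqP; split => [x xS k _ l _|x xS k l]; [exact: xS|exact: xS].
apply: bigcapT_measurable => k; apply: bigcapT_measurable => l.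
have [kl|_] := boolP (k < l <= n)%N; last first.
  by rewrite (_ : [set x | _] = setT)//; apply/seteqP; split.
pose F (x : Rn R n) : R := \sum_(j < n | (k <= j < l)%N) (tnth x j : R) ^+ 2.
have mF : measurable_fun setT F.
  rewrite (_ : F = fun x => \sum_(j < n) if (k <= j < l)%N then (tnth x j : R) ^+ 2 else 0).
    apply: measurable_sum => j; case: (k <= j < l)%N; last exact: measurable_cst.
    by apply: measurable_funX; exact: measurable_coord.
  by apply/funext => x; rewrite /F big_mkcond.
rewrite (_ : [set x | _] = setT `&` F @^-1` `]-oo, sigma + (l - k)%:R * rho]).
  exact: mF.
by apply/seteqP; split => x /=; rewrite in_itv/= => h; [split => //; exact: h|case: h].
Qed.

Lemma power_constrained0 n : power_constrained n sigma rho [tuple 0 | i < n].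
Proof.
move=> k l _; rewrite big1 ?addr_ge0 ?mulr_ge0// => j _.
by rewrite tnth_mktuple expr0n.
Qed.

(** Cutting a window of a concatenated word at the block boundaries produces windows that are empty
    or overrun their block; the bound is extended to these. *)
Lemma power_constrained_window n (x : Rn R n) k l :
  power_constrained n sigma rho x -> (k <= l)%N ->
  \sum_(j < n | (k <= j < l)%N) (tnth x j : R) ^+ 2 <= sigma + (l - k)%:R * rho.
Proof.
move=> xS kl; have [kn|nk] := ltnP k (minn l n); last first.
  rewrite big_pred0 ?addr_ge0 ?mulr_ge0// => j.
  by apply/negP => /andP[kj jl]; have := ltn_ord j; lia.
rewrite (eq_bigl (fun j : 'I_n => (k <= j < minn l n)%N)); last first.
  by move=> j; have := ltn_ord j; lia.
apply: le_trans (xS k (minn l n) _) _; first by lia.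
by rewrite lerD2l ler_wpM2r// ler_nat; lia.
Qed.

(* Zeros of length k with k rho >= sigma restore the budget of a token bucket,
   so that admissible blocks can be concatenated. *)
Lemma power_constrained_cat n k m (x : Rn R n) (y : Rn R m) :
  sigma <= k%:R * rho ->
  power_constrained n sigma rho x -> power_constrained m sigma rho y ->
  power_constrained (n + (k + m)) sigma rho
    (catv (x, catv ([tuple 0 | i < k] : Rn R k, y))).
Proof.
move=> krho xS yS a l /andP[al ln].
rewrite big_split_ord [X in _ + X <= _]big_split_ord/=.
rewrite [X in _ + (X + _) <= _]big1 ?add0r; last first.
  move=> i _; rewrite tnth_rshift tnth_lshift tnth_mktuple expr0n//.
under eq_bigr do rewrite tnth_lshift.
under [X in _ + X <= _]eq_bigr do rewrite !tnth_rshift.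
have [an|na] := ltnP a n; last first.
  rewrite big_pred0 ?add0r; last by move=> i; have := ltn_ord i; lia.
  rewrite (eq_bigl (fun j : 'I_m => (a - (n + k) <= j < l - (n + k))%N)); last first.
    by move=> j /=; lia.
  apply: le_trans (power_constrained_window yS _) _; first by lia.
  by rewrite lerD2l ler_wpM2r// ler_nat; lia.
have [lnk|nkl] := leqP l (n + k).
  rewrite [X in _ + X <= _]big_pred0 ?addr0; last by move=> i; lia.
  exact: power_constrained_window xS (ltnW al).
rewrite (eq_bigl (fun j : 'I_n => (a <= j < n)%N)); last first.
  by move=> j; have := ltn_ord j; lia.
rewrite [X in _ + X <= _](eq_bigl (fun j : 'I_m => (0 <= j < l - (n + k))%N)); last first.
  by move=> j /=; lia.
(* Here the window meets both blocks and so contains all k zeros, whose allowance k rho pays for the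
   second sigma. *)
apply: le_trans (lerD (power_constrained_window xS (ltnW an))
  (power_constrained_window yS (leq0n _))) _.
have -> : (l - a = (n - a) + k + (l - (n + k) - 0))%N by lia.
by rewrite !natrD; lra.
Qed.

End power_constraint.

Section concatenated_law.
Local Open Scope ereal_scope.
Context (R : realType).

Definition cat_law m n (p : probability (Rn R m) R) (q : probability (Rn R n) R) :
  probability (Rn R (m + n)) R := distribution (p \x q)%E (@catv R m n).

Lemma ge0_integral_cat_law m n (p : probability (Rn R m) R)
    (q : probability (Rn R n) R) (g : Rn R (m + n) -> \bar R) :
  measurable_fun setT g -> (forall x, 0 <= g x) ->
  \int[cat_law p q]_x g x = \int[p]_a \int[q]_b g (catv (a, b)).
Proof.
move=> mg g0; rewrite ge0_integral_distribution//.
rewrite (fubini_tonelli1 (g \o @catv R m n))//.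
- exact: (measurableT_comp mg (@measurable_catv R m n)).
- by move=> z; exact: g0.
Qed.

Lemma ge0_integral_mul d1 d2 (X : measurableType d1) (Y : measurableType d2)
    (p : probability X R) (q : probability Y R)
    (g : X -> \bar R) (h : Y -> \bar R) :
  measurable_fun setT g -> measurable_fun setT h ->
  (forall x, 0 <= g x) -> (forall y, 0 <= h y) ->
  \int[p]_x \int[q]_y (g x * h y) = \int[p]_x g x * \int[q]_y h y.
Proof.
move=> mg mh g0 h0; have ih0 : 0 <= \int[q]_y h y by exact: integral_ge0.
rewrite -ge0_integralZr//.
by apply: eq_integral => x _; rewrite ge0_integralZl.
Qed.

Context (nu : R) (nu_gt0 : (0 < nu)%R).
Local Notation w := (@awgn_density R nu _).
Local Notation mgf n p s := (information_mgf (noise_law nu n) (@awgn_density R nu n) p s).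

Lemma output_density_cat m n (p : probability (Rn R m) R)
    (q : probability (Rn R n) R) (y1 : Rn R m) (y2 : Rn R n) :
  output_density w (cat_law p q) (catv (y1, y2)) =
  (output_density w p y1 * output_density w q y2)%R.
Proof.
have mw k (y : Rn R k) : measurable_fun setT (fun x : Rn R k => (w (x, y))%:E).
  apply/measurable_EFinP.
  exact: (measurableT_comp (@measurable_awgn_density R nu k) (pair2_measurable _)).
have w0 k (z : Rn R k * Rn R k) : 0 <= (w z)%:E.
  by rewrite lee_fin ltW// awgn_density_gt0.
apply: EFin_inj; rewrite EFinM.
rewrite !(output_densityE (@measurable_awgn_density R nu _)
  (@awgn_density_gt0 R nu _) (@awgn_density_le R nu nu_gt0 _)).
rewrite (ge0_integral_cat_law p q (mw _ (catv (y1, y2))) (fun x => w0 _ _)).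
rewrite -(ge0_integral_mul p q (mw _ y1) (mw _ y2) (fun x => w0 _ _)
  (fun x => w0 _ _)).
by do 2 (apply: eq_integral => ? _); rewrite awgn_density_cat EFinM.
Qed.

(** Both [w] and the output density factor over independent blocks, so the information density is
    additive and its exponential factors. *)
Lemma information_mgf_cat m n (p : probability (Rn R m) R)
    (q : probability (Rn R n) R) (s : R) :
  mgf (m + n)%N (cat_law p q) s = mgf m p s * mgf n q s.
Proof.
pose F k (r : probability (Rn R k) R) (z : Rn R k * Rn R k) : \bar R :=
  (w z * expR (- s * information_density w r z))%:E.
have mF k (r : probability (Rn R k) R) : measurable_fun setT (F k r).
  apply/measurable_EFinP; apply: (measurable_mgf_integrand
    (@measurable_awgn_density R nu _) (@awgn_density_gt0 R nu _)
    (@awgn_density_le R nu nu_gt0 _)).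
have F0 k (r : probability (Rn R k) R) z : 0 <= F k r z.
  by rewrite lee_fin mulr_ge0 ?expR_ge0// ltW// awgn_density_gt0.
have mF1 k (r : probability (Rn R k) R) x : measurable_fun setT (fun y => F k r (x, y)).
  exact: (measurableT_comp (mF k r) (pair1_measurable _)).
have mgfE k (r : probability (Rn R k) R) :
    mgf k r s = \int[r]_x \int[noise_law nu k]_y F k r (x, y).
  rewrite /information_mgf -[LHS]/(integral _ _ (F k r)).
  by rewrite (fubini_tonelli1 (F k r)); [|exact: mF|exact: F0].
rewrite !mgfE.
have mI k (r : probability (Rn R k) R) :
    measurable_fun setT (fun x => \int[noise_law nu k]_y F k r (x, y)).
  exact: (@measurable_fun_fubini_tonelli_F _ _ _ _ _ (noise_law nu k) (F k r) (mF k r) (F0 k r)).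
have I0 k (r : probability (Rn R k) R) x : 0 <= \int[noise_law nu k]_y F k r (x, y).
  exact: integral_ge0.
rewrite (ge0_integral_cat_law p q (mI _ (cat_law p q)) (I0 _ (cat_law p q))).
rewrite -(ge0_integral_mul p q (mI _ p) (mI _ q) (I0 _ p) (I0 _ q)).
apply: eq_integral => x1 _; apply: eq_integral => x2 _.
rewrite (ge0_integral_noise_cat nu (mF1 _ (cat_law p q) (catv (x1, x2)))
  (fun y => F0 _ _ _)).
rewrite -(ge0_integral_mul _ _ (mF1 _ p x1) (mF1 _ q x2)
  (fun y => F0 _ _ _) (fun y => F0 _ _ _)).
apply: eq_integral => y1 _; apply: eq_integral => y2 _.
rewrite /F -EFinM; congr EFin; rewrite awgn_density_cat.
rewrite /information_density /= output_density_cat awgn_density_cat.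
have g0 k (r : probability (Rn R k) R) x y : (0 < w (x, y) / output_density w r y)%R.
  by rewrite divr_gt0 ?awgn_density_gt0// (output_density_gt0
    (@measurable_awgn_density R nu _)  (@awgn_density_gt0 R nu _)
    (@awgn_density_le R nu nu_gt0 _)).
rewrite [X in ln X](_ : _ = (w (x1, y1) / output_density w p y1) *
    (w (x2, y2) / output_density w q y2))%R; last by rewrite invfM mulrACA.
by rewrite (lnM (g0 _ p x1 y1) (g0 _ q x2 y2)) mulrDr expRD mulrACA.
Qed.

(** For the zero word w = f = 1, hence l = 0: padding leaves the Chernoff bound unchanged. *)
Lemma information_mgf_dirac0 k s : mgf k (\d_([tuple 0%R | i < k] : Rn R k)) s = 1.
Proof.
set o : Rn R k := [tuple 0%R | i < k].
have w0 y : w (o, y) = 1%R.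
  rewrite /awgn_density big1 ?mul0r ?expR0// => i _.
  by rewrite /= tnth_mktuple mul0r expr0n mul0r subrr.
have mw := @measurable_awgn_density R nu k.
have mgfi := @measurable_mgf_integrand _ _ _ _ _ _ _ mw (@awgn_density_gt0 R nu _)
    (@awgn_density_le R nu nu_gt0 _) (\d_o) s.
rewrite /information_mgf fubini_tonelli1; last 2 first.
- exact/measurable_EFinP.
- by move=> z; rewrite lee_fin mulr_ge0 ?expR_ge0// ltW// awgn_density_gt0.
rewrite integral_dirac//; last first.
  apply: measurable_fun_fubini_tonelli_F; first exact/measurable_EFinP.
  by move=> z; rewrite lee_fin mulr_ge0 ?expR_ge0// ltW// awgn_density_gt0.
rewrite diracT mul1e /fubini_F -[RHS](integral_cst_probability (noise_law nu k)).
apply: eq_integral => y _; rewrite w0 mul1r /information_density w0.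
have -> : output_density w (\d_o) y = 1%R.
  rewrite /output_density integral_dirac// ?diracT ?mul1e ?w0//.
  by apply/measurable_EFinP; exact: (measurableT_comp mw (pair2_measurable _)).
by rewrite divr1 ln1 mulr0 expR0.
Qed.

End concatenated_law.

Section block_laws.
Context (R : realType) (sigma rho nu : R).
Hypotheses (sigma_ge0 : 0 <= sigma) (rho_ge0 : 0 <= rho) (nu_gt0 : 0 < nu).
Local Notation S n := (power_constrained n sigma rho : set (Rn R n)).
Local Notation mgf n p s := (information_mgf (noise_law nu n) (@awgn_density R nu n) p s).

Lemma input_laws_dirac0 n :
  input_laws n sigma rho (\d_([tuple 0 | i < n] : Rn R n) : probability _ R).
Proof.
rewrite /input_laws/= diracE mem_set//.
exact: power_constrained0.
Qed.

(** The indicator of the constraint on the concatenation dominates the product of the indicators of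
    the two blocks, whose mean is 1. *)
Lemma input_laws_cat n k m (p : probability (Rn R n) R) (q : probability (Rn R m) R) :
  sigma <= k%:R * rho ->
  input_laws n sigma rho p -> input_laws m sigma rho q ->
  input_laws (n + (k + m)) sigma rho
    (cat_law p (cat_law (\d_([tuple 0 | i < k] : Rn R k)) q)).
Proof.
move=> krho pS qS; pose o : Rn R k := [tuple 0 | i < k].
pose r := cat_law p (cat_law (\d_o) q).
change (r (S (n + (k + m))) = 1%E).
have mS j : measurable (S j) by exact: measurable_power_constrained.
have mI j : measurable_fun setT (fun x : Rn R j => (\1_(S j) x)%:E : \bar R).
  by apply/measurable_EFinP; apply: measurable_indic; exact: mS.
have I0 j (x : Rn R j) : (0 <= (\1_(S j) x)%:E :> \bar R)%E by rewrite lee_fin.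
have rE g : measurable_fun setT g -> (forall x, 0 <= g x)%E ->
    (\int[r]_x g x = \int[p]_a \int[cat_law (\d_o) q]_b g (catv (a, b)))%E.
  by move=> mg g0; rewrite ge0_integral_cat_law.
clearbody r.
have rS : (\int[r]_x (\1_(S (n + (k + m))) x)%:E)%E = r (S (n + (k + m))).
  by rewrite integral_indic ?setIT//; exact: mS.
apply/eqP; rewrite eq_le; apply/andP; split; first exact: (probability_le1 r (mS _)).
rewrite -rS.
have -> : (1 = \int[p]_a \int[q]_c ((\1_(S n) a)%:E * (\1_(S m) c)%:E) :> \bar R)%E.
  have intS j (l : probability (Rn R j) R) : input_laws j sigma rho l ->
      (\int[l]_x (\1_(S j) x)%:E = 1)%E.
    by move=> lS; rewrite integral_indic ?setIT//; exact: mS.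
  rewrite ge0_integral_mul//; [|exact: mI..].
  by rewrite (intS _ _ pS) (intS _ _ qS) mule1.
have mSc : measurable_fun setT
    (fun ab : Rn R n * Rn R (k + m) => (\1_(S (n + (k + m))) (catv ab))%:E : \bar R).
  exact: (measurableT_comp (mI (n + (k + m))%N) (@measurable_catv R n (k + m))).
have mSca a : measurable_fun setT
    (fun b : Rn R (k + m) => (\1_(S (n + (k + m))) (catv (a, b)))%:E : \bar R).
  exact: (measurableT_comp mSc (pair1_measurable a)).
have mSac a : measurable_fun setT (fun bc : Rn R k * Rn R m =>
    (\1_(S (n + (k + m))) (catv (a, catv bc)))%:E : \bar R).
  exact: (measurableT_comp (mSca a) (@measurable_catv R k m)).
rewrite rE; [|exact: mI|exact: I0].
apply: ge0_le_integral => //.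
- by move=> a _; apply: integral_ge0 => c _; rewrite mule_ge0 ?I0.
- apply: (@measurable_fun_fubini_tonelli_F _ _ _ _ _ q
    (fun ac => (\1_(S n) ac.1)%:E * (\1_(S m) ac.2)%:E)%E).
    apply: emeasurable_funM.
      exact: (measurableT_comp (mI n) measurable_fst).
    exact: (measurableT_comp (mI m) measurable_snd).
  by move=> z; rewrite mule_ge0 ?I0.
- exact: (@measurable_fun_fubini_tonelli_F _ _ _ _ _ (cat_law (\d_o) q) _ mSc
    (fun z => I0 _ _)).
move=> a _; rewrite ge0_integral_cat_law; [|exact: mSca|by move=> z; rewrite I0].
rewrite integral_dirac//; last first.
  exact: (@measurable_fun_fubini_tonelli_F _ _ _ _ _ q _ (mSac a) (fun z => I0 _ _)).
rewrite diracT mul1e; apply: ge0_le_integral => //.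
- by apply: emeasurable_funM; [exact: measurable_cst|exact: mI].
- exact: (measurableT_comp (mSac a) (pair1_measurable o)).
move=> c _; rewrite -EFinM lee_fin !indicE.
have [aS|_] := boolP (a \in S n); last by rewrite mul0r.
have [cS|_] := boolP (c \in S m); last by rewrite mulr0.
rewrite mem_set ?mul1r//; apply: power_constrained_cat => //; exact: set_mem.
Qed.

(** Codes are needed at every length N, not only at multiples of n + k. Full padded blocks are
    peeled off by induction, and a remainder shorter than n + k is filled with zeros. *)
Lemma block_laws n k (p : probability (Rn R n) R) (s q : R) :
  (0 < n)%N -> sigma <= k%:R * rho -> input_laws n sigma rho p ->
  0 <= q -> (mgf n p s <= q%:E)%E ->
  forall N, exists2 r : probability (Rn R N) R, input_laws N sigma rho r &
    (mgf N r s <= (q ^+ (N %/ (n + k)))%:E)%E.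
Proof.
move=> n0 krho pS q0 pq; elim/ltn_ind => N IH.
have [Nb|bN] := ltnP N (n + k).
  exists (\d_([tuple 0 | i < N] : Rn R N)); first exact: input_laws_dirac0.
  by rewrite information_mgf_dirac0// divn_small.
have [N' NE] : exists N', N = (n + (k + N'))%N by exists (N - (n + k))%N; lia.
have N'N : (N' < N)%N by lia.
have [r rS rq] := IH _ N'N; rewrite {}NE in IH bN N'N *.
exists (cat_law p (cat_law (\d_([tuple 0 | i < k] : Rn R k)) r)).
  exact: input_laws_cat.
rewrite !information_mgf_cat// information_mgf_dirac0// mul1e.
rewrite addnA divnDl ?dvdnn// divnn addn_gt0 n0/= exprS EFinM.
apply: lee_pmul => //; apply: integral_ge0 => z _;
  by rewrite lee_fin mulr_ge0 ?expR_ge0// ltW// awgn_density_gt0.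
Qed.

End block_laws.

(** * The uniform law on a codebook *)

Section uniform_law.
Context d (X : measurableType d) (R : realType) (M : nat) (c : nat -> X).

(** Points are indexed by [nat] to suit [msum]; with [M.+1] of them the normalisation needs no side
    condition. *)
Definition uniform_law : set X -> \bar R :=
  mscale (M.+1%:R^-1)%:nng (msum (fun i => \d_(c i)) M.+1).

HB.instance Definition _ := Measure.on uniform_law.

Lemma uniform_law_setT : uniform_law setT = 1%E.
Proof.
rewrite /uniform_law /mscale/= /msum/=.
under eq_bigr do rewrite diracT.
by rewrite sumEFin sumr_const card_ord -EFinM mulVf.
Qed.

HB.instance Definition _ :=
  Measure_isProbability.Build _ _ _ uniform_law uniform_law_setT.

Lemma uniform_law_all (A : set X) : (forall i : 'I_M.+1, A (c i)) -> uniform_law A = 1%E.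
Proof.
move=> cA; rewrite -uniform_law_setT /uniform_law /mscale/= /msum/=.
by congr (_ * _)%E; apply: eq_bigr => i _; rewrite diracT diracE mem_set.
Qed.

Lemma ge0_integral_uniform_law (g : X -> \bar R) : measurable_fun setT g ->
  (forall x, 0 <= g x)%E ->
  (\int[uniform_law]_x g x = M.+1%:R^-1%:E * \sum_(i < M.+1) g (c i))%E.
Proof.
move=> mg g0; rewrite ge0_integral_mscale//= ge0_integral_measure_sum//.
by congr (_ * _)%E; apply: eq_bigr => i _; rewrite integral_dirac// diracT mul1e.
Qed.

End uniform_law.

(** * Codes *)

Section codes.
Context (R : realType) (sigma rho nu : R) (nu_gt0 : 0 < nu).
Local Notation w n := (@awgn_density R nu n).

Lemma error_probability_ge0 n M (c : code n M sigma rho) :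
  (0 <= error_probability nu c)%E.
Proof.
apply: mule_ge0; first by rewrite lee_fin invr_ge0.
by apply: sume_ge0 => m _; exact: measure_ge0.
Qed.

(** Expresses the probability of correct decoding through the density [w], the form in which both
    Fano's inequality and Feinstein's lemma deliver it. *)
Lemma error_probability_correct n M (c : code n M sigma rho) : (0 < M)%N ->
  (error_probability nu c + M%:R^-1%:E * \sum_(m < M) \int[noise_law nu n]_y
     (if decoder c y == m then w n (encoder c m, y) else 0)%:E = 1)%E.
Proof.
move=> M0; rewrite /error_probability -ge0_muleDr; last 2 first.
- by apply: sume_ge0 => m _; exact: measure_ge0.
- apply: sume_ge0 => m _; apply: integral_ge0 => y _.
  by rewrite lee_fin; case: ifP => // _; exact/ltW/awgn_density_gt0.
rewrite -big_split/=.
rewrite (eq_bigr (fun=> 1%E)); last first.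
  move=> m _; set x := encoder c m.
  pose D := decoder c @^-1` [set m].
  have mD : measurable D by exact: decoder_measurable.
  have mx : measurable_fun setT (fun z => addv x z).
    exact: (measurableT_comp (@measurable_channel_output R n) (pair1_measurable x)).
  have mxD : measurable ((fun z => addv x z) @^-1` D).
    by rewrite -[X in measurable X]setTI; exact: mx.
  have mI : measurable_fun setT (fun y : Rn R n => (\1_D y)%:E : \bar R).
    by apply/measurable_EFinP; exact: measurable_indic.
  have -> : (\int[noise_law nu n]_y
      (if decoder c y == m then w n (x, y) else 0)%:E =
      noise_law nu n ((fun z => addv x z) @^-1` D))%E.
    transitivity (\int[noise_law nu n]_z (\1_D (addv x z))%:E)%E; last first.
      by have := integral_indic (noise_law nu n) measurableT mxD; rewrite setIT.
    rewrite (ge0_integral_awgn nu_gt0 x mI) => [|y]; last by rewrite lee_fin.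
    apply: eq_integral => y _; rewrite -EFinM indicE; congr EFin.
    have [yD|yD] := eqVneq (decoder c y) m; first by rewrite mem_set ?mul1r.
    by rewrite memNset ?mul0r//; apply/eqP.
  rewrite (_ : [set z | _] = ~` ((fun z => addv x z) @^-1` D))//.
  rewrite addeC -measureU//; last 2 first.
  - exact: measurableC.
  - by rewrite setICr.
  by rewrite setUCr; exact: probability_setT.
by rewrite sumEFin sumr_const card_ord -EFinM mulVf// pnatr_eq0 -lt0n.
Qed.

Lemma code_information_ge n M (c : code n M sigma rho) : (0 < M)%N ->
  ((ln M%:R)%:E * (1 - error_probability nu c) <=
   ereal_sup [set channel_information nu p | p in input_laws n sigma rho] + 2%:E)%E.
Proof.
case: M c => // M c _.
pose x (i : nat) : Rn R n := encoder c (inord i).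
have ci := error_probability_correct c isT.
have -> : (1 - error_probability nu c = M.+1%:R^-1%:E *
    \sum_(m < M.+1) \int[noise_law nu n]_y
     (if decoder c y == m then w n (encoder c m, y) else 0)%:E)%E.
  have e0 := error_probability_ge0 c.
  rewrite -ci addeAC subee ?add0e//; rewrite ge0_fin_numE//.
  apply: (@le_lt_trans _ _ 1%E); last exact: ltry.
  rewrite -ci leeDl//; apply: mule_ge0; first by rewrite lee_fin invr_ge0.
  apply: sume_ge0 => m _; apply: integral_ge0 => y _.
  by rewrite lee_fin; case: ifP => // _; exact/ltW/awgn_density_gt0.
have mdec i : measurable (decoder c @^-1` [set i]) by exact: decoder_measurable.
apply: le_trans (information_ge_codebook (p := uniform_law R M x)
  (@measurable_awgn_density R nu n) (@awgn_density_gt0 R nu n)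
  (@awgn_density_le R nu nu_gt0 n) (@integral_awgn_density R nu nu_gt0 n)
  (c := encoder c) isT mdec _) _.
  move=> g mg g0; rewrite (ge0_integral_uniform_law _ _ mg g0).
  by congr (_ * _)%E; apply: eq_bigr => i _; rewrite /x inord_val.
rewrite leeD2r//; apply: ereal_sup_ubound.
exists (uniform_law R M x); last exact: channel_information_density.
by apply: uniform_law_all => i; exact: encoder_constrained.
Qed.

Lemma feinstein_code n M (p : probability (Rn R n) R) (s g eps : R) :
  (0 < M)%N -> 0 <= s -> input_laws n sigma rho p ->
  ((expR (s * g))%:E * information_mgf (noise_law nu n) (w n) p s
    + (M%:R * expR (- g))%:E < eps%:E)%E ->
  exists c : code n M sigma rho, (error_probability nu c <= eps%:E)%E.
Proof.
move=> M0 s0 pS bnd.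
have mw := @measurable_awgn_density R nu n.
have mS : measurable (power_constrained n sigma rho).
  exact: measurable_power_constrained.
have [x xS xP] := feinstein mw (@awgn_density_gt0 R nu n)
  (@awgn_density_le R nu nu_gt0 n) (@integral_awgn_density R nu nu_gt0 n)
  s0 pS mS bnd.
pose hit j y := g < information_density (w n) p (x j, y).
have mhit j : measurable_fun setT (hit j).
  apply: measurable_fun_ltr => //.
  apply: (measurableT_comp _ (pair1_measurable _)).
  exact: (measurable_information_density mw (@awgn_density_gt0 R nu n)
    (@awgn_density_le R nu nu_gt0 n)).
have mfind r : measurable_fun setT (fun y => find (hit ^~ y) r).
  elim: r => [|j r IH] /=; first exact: measurable_cst.
  apply: measurable_fun_ifT => //.
  by apply: (@measurableT_comp _ _ _ _ _ _ succn).
(* The first codeword whose test succeeds; if none does, [find] returns M, which is out of range,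
   and [insubd] falls back on message 0. *)
pose dec y : 'I_M := insubd (Ordinal M0) (find (hit ^~ y) (iota 0 M)).
have mdec m : measurable (dec @^-1` [set m]).
  rewrite -[X in measurable X]setTI.
  exact: (mfind (iota 0 M) measurableT [set j | insubd (Ordinal M0) j = m]).
have encS (m : 'I_M) : power_constrained n sigma rho (x m) by exact: xS.
exists (Code encS mdec); set c := Code _ _.
have := error_probability_correct c M0.
set e := error_probability _ _; set q := (_ * _)%E => eq1.
suff q1 : ((1 - eps)%:E <= q)%E.
  have e0 : (0 <= e)%E by exact: error_probability_ge0.
  have q0 : (0 <= q)%E.
    apply: mule_ge0; first by rewrite lee_fin invr_ge0.
    apply: sume_ge0 => m _; apply: integral_ge0 => y _.
    by rewrite lee_fin; case: ifP => // _; exact/ltW/awgn_density_gt0.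
  move: eq1 q1 e0 q0; case: e => [a||]//; case: q => [b||]//.
  by rewrite -EFinD !lee_fin => -[]; lra.
have MR0 : (0 < M%:R :> R) by rewrite ltr0n.
have -> : ((1 - eps)%:E = M%:R^-1%:E * \sum_(m < M) (1 - eps)%:E)%E.
  by rewrite sumEFin sumr_const card_ord -EFinM -[X in _ * X]mulr_natl mulKf// gt_eqF.
apply: lee_wpmul2l; first by rewrite lee_fin invr_ge0 ltW.
apply: lee_sum => m _; apply: le_trans (xP m (ltn_ord m)) _.
have mwm : measurable_fun setT (fun y => w n (x m, y)).
  exact: (measurableT_comp mw (pair1_measurable _)).
apply: ge0_le_integral_real.
- apply: measurable_fun_ifT => //; apply: measurable_and; first exact: mhit.
  apply: measurable_neg.
  elim: (iota 0 m) => [|j r IH] /=; first exact: measurable_cst.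
  by apply: measurable_or => //; exact: mhit.
- apply: measurable_fun_ifT => //.
  apply: (measurable_fun_bool true) => //; rewrite setTI.
  rewrite (_ : _ @^-1` _ = dec @^-1` [set m]); first exact: mdec.
  by apply/seteqP; split => y /= /eqP.
- by move=> y; case: ifP => // _; exact/ltW/awgn_density_gt0.
move=> y; case: ifP => [/andP[hm nh]|_]; last first.
  by case: ifP => // _; exact/ltW/awgn_density_gt0.
suff -> : decoder c y == m by [].
apply/eqP/val_inj; rewrite /= val_insubd.
(* No test before m succeeds and the one at m does, so [find] stops exactly at m. *)
have -> : iota 0 M = iota 0 m ++ (m : nat) :: iota m.+1 (M - m.+1).
  by rewrite -[in LHS](subnKC (ltnW (ltn_ord m))) iotaD -[in LHS](subnSK (ltn_ord m)).
rewrite find_cat (negbTE nh) size_iota /= {1 3}/hit hm addn0 ltn_ord//.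
Qed.

End codes.

(** * The limit *)

Section capacity.
Context (R : realType) (sigma rho nu : R).
Hypotheses (sigma_ge0 : 0 <= sigma) (rho_ge0 : 0 <= rho) (nu_gt0 : 0 < nu).

Local Notation sup_information n :=
  (ereal_sup [set channel_information nu p | p in input_laws n sigma rho]).

Lemma channel_information_ge0 n (p : probability (Rn R n) R) :
  (0 <= channel_information nu p)%E.
Proof.
rewrite channel_information_density//; apply: integral_ge0 => z _; rewrite lee_fin.
exact: (information_integrand_ge0 (@measurable_awgn_density R nu n)
  (@awgn_density_gt0 R nu n) (@awgn_density_le R nu nu_gt0 n)).
Qed.

Lemma sup_information_ge0 n : (0 <= sup_information n)%E.
Proof.
apply: le_trans (channel_information_ge0 (\d_([tuple 0 | i < n] : Rn R n))) _.
apply: ereal_sup_ubound; exists (\d_([tuple 0 | i < n] : Rn R n)) => //.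
exact: input_laws_dirac0.
Qed.

Lemma achievable_information n k (p : probability (Rn R n) R) (r : R) :
  (0 < n)%N -> sigma <= k%:R * rho -> input_laws n sigma rho p -> 0 <= r ->
  ((r * (n + k)%:R)%:E < channel_information nu p)%E ->
  achievable sigma rho nu r.
Proof.
move=> n0 krho pS r0; rewrite channel_information_density// => rI.
set b : R := (n + k)%:R; have b0 : 0 < b by rewrite ltr0n addn_gt0 n0.
have [a ra aI] : exists2 a : R, r * b < a &
    (a%:E < information (noise_law nu n) (@awgn_density R nu n) p)%E.
  move: rI; rewrite -/b; case: information => [v||]//.
    by rewrite lte_fin => rv; exists ((r * b + v) / 2); rewrite ?lte_fin; lra.
  by move=> _; exists (r * b + 1); rewrite ?ltry//; lra.
have [s /andP[s0 s1] sG] := information_mgf_lt (@measurable_awgn_density R nu n)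
  (@awgn_density_gt0 R nu n) (@awgn_density_le R nu nu_gt0 n)
  (@integral_awgn_density R nu nu_gt0 n) aI.
have rab : r < a / b by rewrite ltr_pdivlMr.
(* Decoding threshold per symbol: the gap r' - r makes the union bound decay, the gap a / b - r' the
   Chernoff term. *)
pose r' := (r + a / b) / 2.
have rr' : r < r' by rewrite /r'; lra.
have r'ab : r' < a / b by rewrite /r'; lra.
have Gq : (information_mgf (noise_law nu n) (@awgn_density R nu n) p s
    <= (expR (- (s * a)))%:E)%E.
  apply: le_trans (ltW sG) _; rewrite lee_fin.
  by have := expR_ge1Dx (- (s * a)); lra.
(* The factor e^(s a) pays for the incomplete last block, as N / b may exceed the number of full
   blocks by up to 1; the summand 1 / (N + 1) provides the strict inequality that Feinstein's lemma
   asks for. *)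
pose eps N : R := expR (s * a) * expR (- (s * (a / b - r'))) ^+ N
  + expR (- (r' - r)) ^+ N + N.+1%:R^-1.
have eps0 : (eps N)%:E @[N --> \oo] --> 0%E.
  apply: cvg_EFin; first exact: nearW.
  have -> : (0 : R) = expR (s * a) * 0 + 0 + 0 by rewrite mulr0 !addr0.
  apply: cvgD; last exact: cvg_harmonic.
  apply: cvgD.
    apply: cvgM; first exact: cvg_cst.
    apply: cvg_expr; rewrite ger0_norm ?expR_ge0// expR_lt1 oppr_lt0.
    by rewrite mulr_gt0// subr_gt0.
  by apply: cvg_expr; rewrite ger0_norm ?expR_ge0// expR_lt1 oppr_lt0 subr_gt0.
have codeE N : exists c : code N (Num.truncn (expR (N%:R * r))) sigma rho,
    (error_probability nu c <= (eps N)%:E)%E.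
  have [q qS qG] := block_laws sigma_ge0 rho_ge0 nu_gt0 n0 krho pS (expR_ge0 _) Gq N.
  have M0 : (0 < Num.truncn (expR (N%:R * r)))%N.
    by rewrite truncn_gt0 -expR0 ler_expR mulr_ge0.
  apply: (feinstein_code nu_gt0 (g := N%:R * r') M0 (ltW s0) qS).
  apply: (@le_lt_trans _ _ ((expR (s * (N%:R * r')))%:E *
    (expR (- (s * a)) ^+ (N %/ (n + k)))%:E + (expR (N%:R * r) * expR (- (N%:R * r')))%:E)%E).
    apply: leeD; first by rewrite lee_wpmul2l// lee_fin expR_ge0.
    by rewrite lee_fin ler_wpM2r ?expR_ge0// truncn_le expR_ge0.
  rewrite -EFinM -EFinD lte_fin /eps.
  rewrite -addrA; apply: ler_ltD; last first.
    by rewrite -!expRM_natl -expRD ltr_pwDr// ?invr_gt0// ler_expR; lra.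
  rewrite -!expRM_natl -!expRD ler_expR.
  have Nb : N%:R <= ((N %/ (n + k))%:R + 1) * b.
    rewrite natr1 -natrM ler_nat; apply/ltnW.
    by apply: ltn_ceil; rewrite addn_gt0 n0.
  have {}Nb : N%:R / b <= (N %/ (n + k))%:R + 1 by rewrite ler_pdivrMr.
  have a0 : 0 <= a by apply: le_trans (ltW ra); rewrite mulr_ge0// ltW.
  have := ler_wpM2l (mulr_ge0 (ltW s0) a0) Nb.
  set x := _%:R; set y := (N %/ _)%:R; set z := b^-1; lra.
exists (fun N => sval (cid (codeE N))).
apply: (@squeeze_cvge _ _ _ _ (fun=> 0%E) _ (fun N => (eps N)%:E)) => //.
- apply: nearW => N; rewrite error_probability_ge0/=.
  exact: (svalP (cid (codeE N))).
- exact: cvg_cst.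
Qed.

Lemma achievable0 : achievable sigma rho nu 0.
Proof.
(* Rate 0 means a single message; the size is generalised to a variable because the type of codes
   depends on it. *)
suff H n M : M = 1%N -> exists c : code n M sigma rho, error_probability nu c = 0%E.
  have M1 n : Num.truncn (expR (n%:R * 0 : R)) = 1%N by rewrite mulr0 expR0 truncn1.
  exists (fun n => sval (cid (H n _ (M1 n)))).
  rewrite (_ : (fun n => _) = cst 0%E); first exact: cvg_cst.
  by apply/funext => n; case: cid.
move=> ->.
have mD m : measurable ((fun=> ord0 : 'I_1) @^-1` [set m] : set (Rn R n)).
  rewrite (_ : _ @^-1` _ = setT)//; apply/seteqP; split => // y _ /=.
  by rewrite [m]ord1.
exists (Code (fun=> power_constrained0 sigma_ge0 rho_ge0 (n := n)) mD).
rewrite /error_probability big_ord1/=.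
rewrite (_ : [set z | _] = set0) ?measure0 ?mule0//.
by apply/seteqP; split => z //= [].
Qed.

Lemma capacity_ge0 : (0 <= capacity sigma rho nu)%E.
Proof. by apply: ereal_sup_ubound; exists 0 => //; exact: achievable0. Qed.

Lemma information_rate_ge (x : R) : (x%:E < capacity sigma rho nu)%E ->
  \forall n \near \oo, (x%:E <= n%:R^-1%:E * sup_information n)%E.
Proof.
case: (leP x 0) => [x0 _|x0].
  apply: nearW => n; apply: (@le_trans _ _ 0%E); first by rewrite lee_fin.
  by rewrite mule_ge0 ?sup_information_ge0// lee_fin invr_ge0.
move=> /ereal_sup_gt[_ [r [c c0] <-]]; rewrite lte_fin => xr.
have r0 : 0 < r by exact: lt_trans xr.
pose e := r - x; have e0 : 0 < e by rewrite subr_gt0.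
(* An error below e / (2 r) costs at most e / 2 of the rate r; the other half of e absorbs the
   additive constants. *)
have d0 : 0 < e / (2 * r) by rewrite divr_gt0// mulr_gt0.
have nearerr : \forall n \near \oo,
    (error_probability nu (c n) < (e / (2 * r))%:E)%E.
  have /fine_cvgP[finerr /cvgr_lt ltr_] := c0.
  near=> n; have fn : error_probability nu (c n) \is a fin_num by near: n.
  rewrite -(fineK fn) lte_fin; near: n.
  exact: ltr_.
near=> n.
have n0 : (0 < n)%N by near: n; exact: nbhs_infty_gt.
have nR0 : 0 < n%:R :> R by rewrite ltr0n.
(* The additive losses are 2 from Fano's inequality and at most 1 from rounding the number of
   messages; 3 <= n e / 2 is this condition. *)
have ne : 6 / e <= n%:R by near: n; exact: nbhs_infty_ger.
have err : (error_probability nu (c n) < (e / (2 * r))%:E)%E by near: n.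
set E := expR (n%:R * r).
have M0 : (0 < Num.truncn E)%N by rewrite truncn_gt0 -expR0 ler_expR mulr_ge0 ?ltW.
have MR0 : 0 < (Num.truncn E)%:R :> R by rewrite ltr0n.
(* Rounding down a number whose integer part is at least 1 loses at most a factor 2, and ln 2 <=
   1. *)
have lnM : n%:R * r - 1 <= ln (Num.truncn E)%:R.
  have ln2 : ln 2 <= 1 :> R by apply: (@le_ln1Dx R 1); lra.
  have E2 : E / 2 <= (Num.truncn E)%:R.
    have : E < (Num.truncn E).+1%:R by exact: truncnS_gt.
    have : 1 <= (Num.truncn E)%:R :> R by rewrite ler1n.
    by rewrite -natr1; lra.
  have E0 : 0 < E by exact: expR_gt0.
  have : ln (E / 2) <= ln (Num.truncn E)%:R by rewrite ler_ln ?posrE// divr_gt0.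
  by rewrite lnM ?posrE ?invr_gt0// lnV ?posrE// expRK; lra.
have := code_information_ge nu_gt0 (c n) M0.
have := error_probability_ge0 nu (c n); move: err.
case: (error_probability nu (c n)) => [q||]//; rewrite lte_fin lee_fin => qe q0.
rewrite -EFinB -EFinM => h.
have qr : q * r <= e / 2.
  by have := ltW qe; rewrite ler_pdivlMr ?mulr_gt0//; lra.
have q1 : q <= 1.
  have rr : e <= r by rewrite /e; lra.
  by rewrite -(ler_pM2r r0) mul1r; lra.
have key : ((n%:R * x)%:E <= sup_information n)%E.
  rewrite -(@leeD2rE _ 2%:E)//; apply: le_trans h; rewrite -EFinD lee_fin.
  have h1 : (n%:R * r - 1) * (1 - q) <= ln (Num.truncn E)%:R * (1 - q).
    by rewrite ler_wpM2r// subr_ge0.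
  have h2 : 6 <= n%:R * e by rewrite -ler_pdivrMr.
  have h3 : n%:R * (q * r) <= n%:R * (e / 2) by rewrite ler_wpM2l// ltW.
  apply: le_trans h1; move: h2 h3; rewrite /e; lra.
rewrite -[X in X%:E](mulKf (lt0r_neq0 nR0)) EFinM.
by rewrite lee_wpmul2l// lee_fin invr_ge0 ltW.
Unshelve. all: end_near. Qed.

(** Given x, the mean of w (x, Y) is e^(|x|^2 / nu), at most e^(sigma / nu) on the support of [p];
    Jensen's bound [information_le] applies with this t. *)
Lemma sup_information_le_energy n : rho = 0 -> (sup_information n <= (sigma / nu)%:E)%E.
Proof.
move=> rho0; apply: ge_ereal_sup => _ [p pS <-].
have t1 : 1 <= expR (sigma / nu) by rewrite -expR0 ler_expR divr_ge0// ltW.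
have mw := @measurable_awgn_density R nu n.
rewrite channel_information_density// -(expRK (sigma / nu)).
apply: (information_le mw (@awgn_density_gt0 R nu n)
  (@awgn_density_le R nu nu_gt0 n) (@integral_awgn_density R nu nu_gt0 n)) => //.
have mw2 : measurable_fun setT (fun z : Rn R n * Rn R n => (awgn_density nu z ^+ 2)%:E : \bar R).
  by apply/measurable_EFinP; exact: (measurable_funX _ mw).
rewrite (fubini_tonelli1 _ mw2) => [|z]; last by rewrite lee_fin sqr_ge0.
rewrite -(integral_cst_probability p (expR (sigma / nu))%:E).
apply: ae_ge0_le_integral => //.
- by move=> x _; apply: integral_ge0 => y _; rewrite lee_fin sqr_ge0.
- by apply: (measurable_fun_fubini_tonelli_F _ mw2) => z; rewrite lee_fin sqr_ge0.
have mS : measurable (power_constrained n sigma rho).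
  exact: measurable_power_constrained.
exists (~` power_constrained n sigma rho); split; first exact: measurableC.
  transitivity (1 - p (power_constrained n sigma rho))%E; first exact: probability_setC.
  by rewrite pS subee.
move=> x /=; apply: contra_not => xS _.
rewrite /fubini_F integral_awgn_density_sqr// lee_fin ler_expR ler_pM2r ?invr_gt0//.
(* The constraint speaks of nonempty windows only, so the whole word is such a window just for
   positive length. *)
case: n p pS mw mw2 mS x xS => [|n] p pS mw mw2 mS x xS; first by rewrite big_ord0.
have := xS 0%N n.+1; rewrite ltn0Sn leqnn => /(_ isT); rewrite rho0 mulr0 addr0; apply: le_trans.
rewrite le_eqVlt; apply/orP; left; apply/eqP; apply: eq_bigl => i /=.
by rewrite ltn_ord.
Qed.

Lemma information_rate_le (x : R) : (capacity sigma rho nu < x%:E)%E ->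
  \forall n \near \oo, (n%:R^-1%:E * sup_information n <= x%:E)%E.
Proof.
move=> Cx.
have x0 : 0 < x by rewrite -lte_fin (le_lt_trans capacity_ge0).
have [rho0|rho_neq0] := eqVneq rho 0.
  near=> n.
  have nR0 : 0 < n%:R :> R by rewrite ltr0n; near: n; exact: nbhs_infty_gt.
  have nx : sigma / nu / x <= n%:R by near: n; exact: nbhs_infty_ger.
  apply: (@le_trans _ _ (n%:R^-1%:E * (sigma / nu)%:E)%E).
    by rewrite lee_wpmul2l ?sup_information_le_energy// lee_fin invr_ge0.
  by rewrite -EFinM lee_fin ler_pdivrMl// -ler_pdivrMr.
have rho_gt0 : 0 < rho by rewrite lt_neqAle eq_sym rho_neq0.
pose k := Num.truncn (sigma / rho).
have krho : sigma <= k.+1%:R * rho.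
  by rewrite -ler_pdivrMr// ltW// truncnS_gt.
(* A rate strictly between C and x leaves room for the padding: r (n + k + 1) <= n x once n >= r (k
   + 1) / (x - r). A law with information above n x would then make r > C achievable. *)
have [r r0 [Cr rx]] : exists2 r : R, 0 <= r &
    (capacity sigma rho nu < r%:E)%E /\ r < x.
  move: Cx capacity_ge0; case: (capacity sigma rho nu) => [C||]//.
  rewrite !lte_fin lee_fin => Cx C0.
  by exists ((C + x) / 2); rewrite ?lte_fin; [|split]; lra.
near=> n.
have n0 : (0 < n)%N by near: n; exact: nbhs_infty_gt.
have nR0 : 0 < n%:R :> R by rewrite ltr0n.
have nrx : r * k.+1%:R / (x - r) <= n%:R by near: n; exact: nbhs_infty_ger.
suff sx : (sup_information n <= (n%:R * x)%:E)%E.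
  rewrite -[X in (_ <= X%:E)%E](mulKf (lt0r_neq0 nR0)) [X in (_ <= X)%E]EFinM.
  by rewrite lee_wpmul2l// lee_fin invr_ge0 ltW.
apply: ge_ereal_sup => _ [p pS <-]; rewrite leNgt; apply/negP => xI.
have : (r%:E <= capacity sigma rho nu)%E.
  apply: ereal_sup_ubound; exists r => //.
  apply: (achievable_information n0 krho pS r0).
  apply: le_lt_trans xI; rewrite lee_fin natrD.
  by move: nrx; rewrite ler_pdivrMr ?subr_gt0//; lra.
by rewrite leNgt Cr.
Unshelve. all: end_near. Qed.

(** The capacity is an extended real, so both finite and infinite limits are covered; at +oo the
    upper premise is vacuous and the lower one is the definition of divergence. *)
Lemma ereal_cvg_between (u : nat -> \bar R) (l : \bar R) : (0 <= l)%E ->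
  (forall x : R, (x%:E < l)%E -> \forall n \near \oo, (x%:E <= u n)%E) ->
  (forall x : R, (l < x%:E)%E -> \forall n \near \oo, (u n <= x%:E)%E) ->
  u @ \oo --> l.
Proof.
case: l => [l||]// _ lo hi.
  apply/fine_cvgP; split.
    have h1 := lo (l - 1); have h2 := hi (l + 1).
    near=> n; rewrite fin_numElt; apply/andP; split.
      apply: (@lt_le_trans _ _ (l - 1)%:E); first exact: ltNyr.
      by near: n; apply: h1; rewrite lte_fin; lra.
    apply: (@le_lt_trans _ _ (l + 1)%:E); last exact: ltry.
    by near: n; apply: h2; rewrite lte_fin; lra.
  apply/cvgrPdist_le => e e0.
  have h1 := lo (l - e); have h2 := hi (l + e).
  near=> n.
  have u1 : ((l - e)%:E <= u n)%E by near: n; apply: h1; rewrite lte_fin; lra.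
  have u2 : (u n <= (l + e)%:E)%E by near: n; apply: h2; rewrite lte_fin; lra.
  move: u1 u2; rewrite /comp; case: (u n) => [v||]//=.
  by rewrite !lee_fin => u1 u2; rewrite ler_norml; apply/andP; split; lra.
apply/cvgeyPge => A; apply: lo; exact: ltry.
Unshelve. all: end_near. Qed.

End capacity.

Unset Implicit Arguments.

Theorem theorem2p1 (R : realType) (sigma rho nu : R)
    (sigma_ge0 : 0 <= sigma) (rho_ge0 : 0 <= rho) (nu_gt0 : 0 < nu) :
  ((n%:R^-1)%:E *
     ereal_sup [set channel_information nu p | p in input_laws n sigma rho])%E
    @[n --> \oo] --> capacity sigma rho nu.
Proof.
apply: ereal_cvg_between.
- exact: capacity_ge0.
- exact: information_rate_ge.
- exact: information_rate_le.
Qed.
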